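(* Let $n\ge 2$, let $K:\mathcal{D}\to[0,\infty)$ be a map and let $\sigma_i$, $i=1,\ldots,n$, be positive Borel measures on $\mathbb{R}^d$. Let $1<p_i<\infty$ for $i=1,\ldots,n$ and suppose $\sum_{i=1}^n\frac1{p_i}<1$. For each permutation $\phi\in S_n$, let the exponents $r^{\phi}_1,\ldots,r^{\phi}_{n-1}$, $r$ and the maps $K^{\phi}_1,\ldots,K^{\phi}_{n-1}$ on $\mathcal{D}$ be as defined in the context. The following statements are equivalent: (a) The $n$ linear embedding theorem holds: there is a finite constant $c_1$ such that for all $f_i\in L^{p_i}(d\sigma_i)$, $i=1,\ldots,n$, $$\sum_{Q\in\mathcal{D}}K(Q)\prod_{i=1}^n\left|\int_{Q}f_i\,d\sigma_i\right|\le c_1\prod_{i=1}^n\|f_i\|_{L^{p_i}(d\sigma_i)}<\infty;$$ (b) There is a finite constant $c_2$ such that for all $\phi\in S_n$, $$\left\|\left(\sum_{Q\in\mathcal{D}}K^{\phi}_{n-1}(Q)\,1_{Q}\right)^{1/r^{\phi}_{n-1}}\right\|_{L^r(d\sigma_{\phi(n)})}\le c_2<\infty.$$ Moreover, the least possible $c_1$ and $c_2$ are equivalent.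
   Context: $\mathcal{D}$ denotes the family of all dyadic cubes $Q=2^{-k}(m+[0,1)^d)$, $k\in\mathbb{Z}$, $m\in\mathbb{Z}^d$, in $\mathbb{R}^d$. The sum $\sum_{Q'\subset Q}$ runs over all $Q'\in\mathcal{D}$ with $Q'\subset Q$ (including $Q'=Q$). $1_E$ is the characteristic function of a set $E$. $S_n$ is the symmetric group of all permutations of $\{1,\ldots,n\}$. Exponents: for $\phi\in S_n$, define $r^{\phi}_j$ for $j=1,\ldots,n-1$, and $r$, by $$\frac1{r^{\phi}_j}+\sum_{i=1}^{j}\frac1{p_{\phi(i)}}=1\quad(j=1,\ldots,n-1),\qquad \frac1r+\sum_{i=1}^n\frac1{p_{\phi(i)}}=1$$ (so $r$ does not depend on $\phi$). Maps: for $\phi\in S_n$ and $Q\in\mathcal{D}$, define $$K^{\phi}_1(Q):=K(Q)\,\sigma_{\phi(1)}(Q)\left(\frac1{\sigma_{\phi(1)}(Q)}\sum_{Q'\subset Q}K(Q')\prod_{i=1}^n\sigma_{\phi(i)}(Q')\right)^{r^{\phi}_1-1}$$ and, inductively, for $j=2,\ldots,n-1$, $$K^{\phi}_j(Q):=K^{\phi}_{j-1}(Q)\,\sigma_{\phi(j)}(Q)\left(\frac1{\sigma_{\phi(j)}(Q)}\sum_{Q'\subset Q}K^{\phi}_{j-1}(Q')\prod_{i=j}^n\sigma_{\phi(i)}(Q')\right)^{r^{\phi}_j/r^{\phi}_{j-1}-1}.$$ Convention: if $\sigma_{\phi(j)}(Q)=0$, then $K^{\phi}_j(Q)$ is taken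 to be $0$. That the least possible constants $c_1$ and $c_2$ are equivalent means that each is bounded by a constant multiple of the other, the multiplicative constants being independent of $K$ and of the measures $\sigma_i$.
   Formalization: The positive Borel measures σ_i are assumed locally finite (finite on compact sets, equivalently on every dyadic cube); otherwise the integrals and the maps K_j can be undefined and the equivalence fails, e.g. for σ_1 = ∞·δ_0, σ_2 = δ_0. *)

(* Defs.v *)
From mathcomp Require Import all_boot all_order all_algebra perm.
From mathcomp Require Import all_classical all_reals all_analysis.

Set Implicit Arguments.
Unset Strict Implicit.
Unset Printing Implicit Defensive.

Import Order.TTheory GRing.Theory Num.Theory.
Import numFieldNormedType.Exports.

Local Open Scope classical_set_scope.
Local Open Scope ring_scope.

(* R^d with its Borel sigma-algebra *)
Definition borelRd (R : realType) (d : nat) :=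
  g_sigma_algebraType (@open 'rV[R]_d).

Section Definitions.
Variables (R : realType) (d : nat).
Notation Rd := (borelRd R d).
Notation borel_measure := {measure set Rd -> \bar R}.

(* The integrals of L^p functions over dyadic cubes, hence the embedding
   inequality below, only make sense for measures that are finite on bounded
   sets. *)
Definition locally_finite (mu : borel_measure) : Prop :=
  forall A : set 'rV[R]_d, compact A -> (mu A < +oo)%E.

Definition dyadic_cube (k : int) (m : 'I_d -> int) : set Rd :=
  [set x : 'rV[R]_d | forall i, 2 ^ (- k) * (m i)%:~R <= x ord0 i
                                  < 2 ^ (- k) * ((m i)%:~R + 1)].

Definition dyadic : set (set Rd) :=
  [set Q | exists k m, Q = dyadic_cube k m].

(* A family of n.+1 objects is indexed by 'I_n.+1, so that the mathematical
   index i is the ordinal i - 1; the number of measures is n.+1. *)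
Variable n : nat.

Section Exponents.
Variable p : 'I_n.+1 -> R.

(* 1 / r_j + \sum_(1 <= i <= j) 1 / p_(phi i) = 1; in particular r_0 = 1 *)
Definition rphi (phi : 'S_n.+1) (j : nat) : R :=
  (1 - \sum_(i < n.+1 | (i < j)%N) (p (phi i))^-1)^-1.

Definition rexp : R := (1 - \sum_(i < n.+1) (p i)^-1)^-1.

Section Maps.
Variables (K : set Rd -> R) (sigma : 'I_n.+1 -> borel_measure).

Local Open Scope ereal_scope.

(* With K_0 = K and r_0 = 1, the definition of K_1 is the case j = 1 of the
   recursion defining K_j from K_(j-1). The values may be +oo. *)
Fixpoint Kphi (phi : 'S_n.+1) (j : nat) (Q : set Rd) : \bar R :=
  if j is j'.+1 then
    let s := sigma (phi (inord j')) in
    if s Q == 0 then 0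
    else Kphi phi j' Q * s Q *
      ((s Q)^-1 *
       \esum_(Q' in [set Q' | dyadic Q' /\ Q' `<=` Q])
          (Kphi phi j' Q' * \prod_(i < n.+1 | (j' <= i)%N) sigma (phi i) Q'))
      `^ (rphi phi j'.+1 / rphi phi j' - 1)%R
  else (K Q)%:E.

Definition embedding_bound (c : R) : Prop :=
  forall f : 'I_n.+1 -> Rd -> R,
    (forall i, f i \in Lfun (sigma i) (p i)%:E) ->
    \esum_(Q in dyadic)
       ((K Q)%:E * \prod_(i < n.+1) `| \int[sigma i]_(x in Q) (f i x)%:E |)
    <= c%:E * \prod_(i < n.+1) 'N[sigma i]_(p i)%:E [EFin \o f i].

Definition testing_bound (c : R) : Prop :=
  forall phi : 'S_n.+1,
    'N[sigma (phi ord_max)]_rexp%:E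
      [(fun x => (\esum_(Q in dyadic) (Kphi phi n Q * (\1_Q x)%:E))
                 `^ (rphi phi n)^-1)]
    <= c%:E.

End Maps.
End Exponents.

End Definitions.

(* +oo when there is no admissible constant *)
Definition least_constant (R : realType) (P : R -> Prop) : \bar R :=
  ereal_inf [set c%:E | c in [set c : R | 0 <= c /\ P c]].

(* Main.v *)
Require Import Defs.
From mathcomp Require Import all_boot all_order all_algebra perm.
From mathcomp Require Import finmap.
From mathcomp Require Import all_classical all_reals all_analysis.
From mathcomp Require Import measurable_realfun matrix_normedtype ring lra.
Set Implicit Arguments.
Unset Strict Implicit.
Unset Printing Implicit Defensive.
Import Order.TTheory GRing.Theory Num.Theory.
Import numFieldNormedType.Exports.

Local Open Scope ring_scope.

(** Up to increasing limits, both conditions only see finitely many cubes.  In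
    a finite family of dyadic cubes, the atom of a cube is the part of it that
    no smaller cube of the family covers.  Only the masses of the atoms matter:
    they are nonnegative weights [w] on a finite forest, in which [mass w x],
    the sum of the weights below [x], is the measure of the cube [x].  A
    constant for the embedding is one that works in all finite families
    ([embedding_boundP]): one direction tests on step functions, the other
    replaces a function by its averages over the atoms, which does not increase
    its norm.  The maps K_j are increasing limits of the maps built from finite
    families ([Krestr_incr_to]), so that a constant for the testing condition is
    also one that works in all finite families ([testing_boundP], by monotone
    convergence).  It remains to treat a finite forest, with constants that
    depend on the exponents only.  Write N for the number of measures, r_0 = 1,
    K_0 = K, and <g>_Q for the average of g over Q.

    From the embedding to the testing condition.  By induction on j, the
    (N - j)-linear form with kernel K_j is bounded by C c^(r_j) on the product
    of the spaces L^(p_i / r_j)(sigma_i), i > j ([embedding_at]).  To pass from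
    j - 1 to j, let s = r_j / r_(j-1).  Given g_i for i > j, use the functions
    f_i = (M g_i)^(1/s), and f_j = (M h)^(s-1), where M is the maximal operator
    of the measure at hand and h is the density that the form with arguments
    f_i, i > j, leaves in the j-th variable.  As M g_i >= <g_i>_Q on Q, the
    form at these functions dominates the sum of K_j(Q) times the integrals of
    the g_i over Q ([KdiscS_prod_le]), and the maximal theorem bounds their
    norms ([embedding_atS]).  For j = N - 1 a single function is left, and
    duality gives the testing condition ([testing_sum_le]).

    From the testing condition to the embedding.  The principal cube of f_i
    above Q is the largest cube above Q at which the maximal average of f_i has
    the same binary order of magnitude as at Q.  The principal cubes of
    f_1, ..., f_N above Q are pairwise comparable because they contain Q, so
    some permutation phi sorts them.  This splits the sum over Q into N! sums,
    and phi says in which order the measures are to be integrated out.  In one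
    of these sums, group the cubes by their successive principal cubes.  On
    each group of step j, [local_testing] replaces K_(j-1) by K_j at the price
    of a power of the measure of the principal cube, and Hoelder's inequality
    sums the groups ([nested_boundS]).  The sums of <f_i>^(p_i) sigma_i over
    principal cubes that come out are bounded by the norms of the f_i
    ([carleson_embedding]), and the kernel that remains after N steps is bounded
    by the testing condition ([sum_Kdisc_le_testing]). *)

(** * Powers and Hoelder's inequality *)

Lemma big_option (V : Type) (idx : V) (op : Monoid.com_law idx) (J : finType)
    (F : option J -> V) :
  \big[op/idx]_o F o = op (F None) (\big[op/idx]_j F (Some j)).
Proof.
rewrite (bigD1 None)//=; congr (op _ _).
rewrite (reindex_omap (@Some J) id)/=; last by case.
by apply: eq_bigl => j; rewrite eqxx.
Qed.

Section Powers.
Variable R : realType.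
Implicit Types (x y t s : R).

Lemma powR_le2r s x y : 0 <= s -> 0 <= x -> x <= y -> x `^ s <= y `^ s.
Proof.
move=> s0 x0 xy; apply: ge0_ler_powR => //; rewrite nnegrE //.
exact: le_trans xy.
Qed.

Lemma powR_prod (J : Type) (r : seq J) (P : pred J) (F : J -> R) s :
  (forall j, P j -> 0 <= F j) ->
  (\prod_(j <- r | P j) F j) `^ s = \prod_(j <- r | P j) F j `^ s.
Proof.
move=> F0.
have : 0 <= \prod_(j <- r | P j) F j /\
    (\prod_(j <- r | P j) F j) `^ s = \prod_(j <- r | P j) F j `^ s.
  elim/big_rec2 : _ => [|j x y Pj [y0 <-]]; first by rewrite powR1.
  by split; [rewrite mulr_ge0 ?F0|rewrite powRM ?F0].
by case.
Qed.

Lemma powR_sumr (J : finType) (P : pred J) t (e : J -> R) :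
  0 < t -> t `^ (\sum_(j | P j) e j) = \prod_(j | P j) t `^ e j.
Proof.
move=> t0; elim/big_rec2 : _ => [|j x y Pj <-]; first by rewrite powRr0.
by rewrite powRD// (gt_eqF t0) implybT.
Qed.

Lemma powR2_gt1 q : 0 < q -> 1 < 2 `^ q :> R.
Proof.
move=> q0; rewrite /powR pnatr_eq0/= expR_gt1 mulr_gt0//.
by rewrite ln_gt0// ltr1n.
Qed.

(** Absorbs a power of the finite quantity [X] into the left-hand side; this is
    how an inequality tested on a function built from [X] itself is used. *)
Lemma self_improve s X Z : 0 < s -> 0 <= X -> 0 <= Z ->
  X <= Z * X `^ (1 - s^-1) -> X <= Z `^ s.
Proof.
move=> s0; rewrite le_eqVlt => /predU1P[<- _ _|X0 Z0 XZ]; first exact: powR_ge0.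
have XX : X = X `^ s^-1 * X `^ (1 - s^-1).
  by rewrite -powRD ?subrKC ?powRr1 ?(ltW X0)// (gt_eqF X0) implybT.
have : X `^ s^-1 <= Z.
  by rewrite {1}XX ler_pM2r ?powR_gt0// in XZ.
move=> /(powR_le2r (ltW s0) (powR_ge0 _ _)).
by rewrite -powRrM mulVf ?(gt_eqF s0)// powRr1// ltW.
Qed.

(** Weighted arithmetic-geometric mean: with [m] the arithmetic mean, multiply
    the inequalities [t <= m * expR (t / m - 1)]. *)
Lemma weighted_amgm (J : finType) (e t : J -> R) :
  (forall j, 0 <= e j) -> \sum_j e j = 1 -> (forall j, 0 <= t j) ->
  \prod_j t j `^ e j <= \sum_j e j * t j.
Proof.
move=> e0 e1 t0; set m := \sum_j e j * t j.
have m0 : 0 <= m by apply: sumr_ge0 => j _; rewrite mulr_ge0.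
have [mE|m_neq0] := eqVneq m 0.
  have /existsP[j ej] : [exists j, 0 < e j].
    rewrite -[X in is_true X]negbK negb_exists; apply/negP => /forallP eN.
    move: e1; rewrite big1 => [/eqP|j _]; first by rewrite eq_sym oner_eq0.
    by apply/eqP; rewrite eq_le e0 andbT leNgt eN.
  have tj : t j = 0.
    have : e j * t j = 0.
      by apply: (psumr_eq0P _ mE) => // i _; rewrite mulr_ge0.
    by move/eqP; rewrite mulf_eq0 gt_eqF//= => /eqP.
  by rewrite (bigD1 j)//= tj powR0 ?gt_eqF// mul0r mE.
have {}m0 : 0 < m by rewrite lt_neqAle eq_sym m_neq0.
have H j : t j `^ e j <= m `^ e j * expR (e j * (t j / m - 1)).
  rewrite [e j * (_ - _)]mulrC expRM -powRM ?(ltW m0) ?expR_ge0//.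
  apply: powR_le2r => //; rewrite -ler_pdivrMl// mulrC.
  by rewrite (le_trans _ (expR_ge1Dx _))// subrKC.
apply: (@le_trans _ _ (\prod_j (m `^ e j * expR (e j * (t j / m - 1))))).
  by apply: ler_prod => j _; rewrite powR_ge0 H.
rewrite big_split/= -powR_sumr// e1 powRr1 ?(ltW m0)// -expR_sum.
under eq_bigr do rewrite mulrBr mulr1 mulrA.
by rewrite sumrB -mulr_suml -/m e1 mulfV// subrr expR0 mulr1.
Qed.

(** Hoelder's inequality for finitely many factors: after division of each
    [x j] by its sum it is the weighted arithmetic-geometric mean. *)
Lemma hoelder_prod (I J : finType) (e : J -> R) (x : J -> I -> R) :
  (forall j, 0 <= e j) -> \sum_j e j = 1 -> (forall j i, 0 <= x j i) ->
  \sum_i \prod_j x j i `^ e j <= \prod_j (\sum_i x j i) `^ e j.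
Proof.
move=> e0 e1 x0; set X := fun j => \sum_i x j i.
have X0 j : 0 <= X j by apply: sumr_ge0.
have xE j i : x j i = x j i / X j * X j.
  have [Xj|Xj] := eqVneq (X j) 0; last by rewrite divfK.
  by rewrite Xj mulr0; apply: (psumr_eq0P _ Xj).
have xX0 j i : 0 <= x j i / X j by rewrite divr_ge0.
apply: (@le_trans _ _
    (\sum_i (\sum_j e j * (x j i / X j)) * \prod_j X j `^ e j)).
  apply: ler_sum => i _.
  under eq_bigr => j _ do rewrite xE powRM//.
  rewrite big_split/= ler_wpM2r//; last exact: weighted_amgm.
  by apply: prodr_ge0 => j _; exact: powR_ge0.
rewrite -mulr_suml ler_piMl//.
  by apply: prodr_ge0 => j _; exact: powR_ge0.
rewrite exchange_big/= -[leRHS]e1; apply: ler_sum => j _.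
rewrite -mulr_sumr -mulr_suml -/(X j) ler_piMr//.
by have [->|?] := eqVneq (X j) 0; rewrite ?mul0r// mulfV.
Qed.

Lemma ler_sum_sub (I : finType) (P Q : pred I) (F G : I -> R) :
  (forall i, P i -> Q i) -> (forall i, P i -> F i <= G i) ->
  (forall i, Q i -> 0 <= G i) -> \sum_(i | P i) F i <= \sum_(i | Q i) G i.
Proof.
move=> PQ FG G0; rewrite [leRHS](bigID P)/= -[leLHS]addr0 lerD//; last first.
  by apply: sumr_ge0 => i /andP[/G0].
rewrite (eq_bigl P) ?ler_sum// => i.
by apply/andP/idP => [[]//|Pi]; split=> //; exact: PQ.
Qed.

End Powers.

(** * Powers of two *)

Section DyadicFloor.
Variable R : realType.
Implicit Types (t q : R).

(** For positive [x], the largest power of 2 that is at most [x]. *)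
Definition dyadic_floor (x : R) : R :=
  if 0 < x then 2 `^ (Num.floor (ln x / ln 2))%:~R else 0.

Let ln2_gt0 : 0 < ln 2 :> R. Proof. by rewrite ln_gt0// ltr1n. Qed.

Lemma dyadic_floor_ge0 (x : R) : 0 <= dyadic_floor x.
Proof. by rewrite /dyadic_floor; case: ifP => // _; exact: powR_ge0. Qed.

Lemma dyadic_floor_le (x : R) : 0 <= x -> dyadic_floor x <= x.
Proof.
rewrite /dyadic_floor le_eqVlt => /predU1P[<-|x0]; first by rewrite ltxx.
rewrite x0 -[leRHS](lnK x0) /powR pnatr_eq0/= ler_expR -ler_pdivlMr//.
exact: floor_le_tmp.
Qed.

Lemma le_dyadic_floor (x : R) : 0 <= x -> x <= 2 * dyadic_floor x.
Proof.
rewrite /dyadic_floor le_eqVlt => /predU1P[<-|x0].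
  by rewrite ltxx mulr0.
rewrite x0 -{1}(@powRr1 R 2)// -powRD ?pnatr_eq0 ?implybT//.
rewrite -{1}(lnK x0).
rewrite /powR pnatr_eq0/= ler_expR -ler_pdivrMr// addrC -[1]/(1%:~R) -intrD.
by apply: ltW; exact: floorD1_gt.
Qed.

Lemma dyadic_floor_homo (x y : R) : x <= y -> dyadic_floor x <= dyadic_floor y.
Proof.
rewrite /dyadic_floor => xy.
case: ifPn => [x0|_]; last by case: ifP => // _; exact: powR_ge0.
rewrite (lt_le_trans x0 xy) ler_powR ?ler1n// ler_int le_floor//.
by rewrite ler_pM2r ?invr_gt0// ler_ln// posrE// (lt_le_trans x0).
Qed.

(** The only property of the set of values of [dyadic_floor] that the geometric
    sums below use. *)
Lemma dyadic_floor_separated (x y : R) :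
  dyadic_floor x < dyadic_floor y -> 2 * dyadic_floor x <= dyadic_floor y.
Proof.
rewrite /dyadic_floor; case: ifPn => [x0|_]; last first.
  by case: ifP => // _ _; rewrite mulr0 powR_ge0.
case: ifPn => [y0|_]; last by rewrite ltNge powR_ge0.
move=> H; rewrite -{1}(@powRr1 _ 2)// -powRD ?pnatr_eq0 ?implybT//.
rewrite ler_powR ?ler1n// addrC -[1]/(1%:~R) -intrD ler_int.
rewrite -ltzD1 ltrD2r ltNge; apply: contraTN H => H.
by rewrite -leNgt ler_powR ?ler1n// ler_int.
Qed.

Definition geometric_const q : R := (1 - 2 `^ (- q))^-1.

Lemma geometric_const_ge0 q : 0 < q -> 0 <= geometric_const q.
Proof.
move=> q0; rewrite invr_ge0 subr_ge0 powRN invf_le1 ?powR_gt0//.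
exact/ltW/powR2_gt1.
Qed.

(** Peel off the largest term: the others are at most half of it, so they obey
    the same bound with [t / 2]. *)
Lemma geometric_sum_le (I : finType) (A : {set I}) (b : I -> R) q t : 0 < q ->
  (forall x : I, x \in A -> 0 <= b x <= t) -> {in A &, injective b} ->
  (forall x y : I, b x < b y -> 2 * b x <= b y) ->
  \sum_(x in A) b x `^ q <= geometric_const q * t `^ q.
Proof.
move=> q0 + + sep; elim: {A}#|A| {-2}A (eqxx #|A|) t => [|N IH] A.
  rewrite cards_eq0 => /eqP -> t _ _.
  by rewrite big_set0 mulr_ge0 ?powR_ge0 ?geometric_const_ge0.
move=> AN t bA inj.
have /card_gt0P[x0 x0A] : (0 < #|A|)%N by rewrite (eqP AN).
pose M := [arg max_(x > x0 in A) b x]%O.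
have [MA Mmax] : M \in A /\ forall x, x \in A -> b x <= b M.
  by rewrite /M; case: arg_maxP => // M' ? ?; split.
rewrite (big_setD1 M)//=.
have [bM0 bMt] := andP (bA _ MA).
have := IH (A :\ M) _ (b M / 2) _ _; move=> /(_ _)/wrap[].
  by move: AN; rewrite (cardsD1 M) MA.
move=> /(_ _)/wrap[].
  move=> x; rewrite !inE => /andP[xM xA].
  have [-> //=] := andP (bA _ xA) => _.
  rewrite ler_pdivlMr// mulrC sep// lt_neqAle Mmax// andbT.
  by apply: contra xM => /eqP /inj ->.
move=> /(_ _)/wrap[].
  by move=> x y; rewrite !inE => /andP[_ xA] /andP[_ yA]; exact: inj.
move=> H; apply: (@le_trans _ _ (geometric_const q * b M `^ q)); last first.
  by rewrite ler_wpM2l ?geometric_const_ge0// powR_le2r// ltW.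
apply: le_trans (lerD (lexx _) H) _.
rewrite powRM// ?invr_ge0// -powR_inv1// -powRrM mulN1r.
have : 1 - 2 `^ (- q) != 0 :> R.
  by rewrite subr_eq0 eq_sym lt_eqF// powRN invf_lt1 ?powR_gt0 ?powR2_gt1.
rewrite /geometric_const => nz; rewrite le_eqVlt; apply/orP; left; apply/eqP.
field.
exact: nz.
Qed.

End DyadicFloor.

(** * Averages and maximal functions on a finite forest *)

(** [le x y] is meant as the inclusion of the cube [x] in the cube [y]; the
    last hypothesis says that two cubes that contain a third one are nested. *)
Section Forest.
Variables (R : realType) (I : finType) (le : rel I).
Hypotheses (le_refl : reflexive le) (le_asym : antisymmetric le).
Hypothesis le_tr : transitive le.
Hypothesis le_forest : forall x y z, le x y -> le x z -> le y z || le z y.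
Implicit Types (w g b : I -> R) (x y z : I).

(** The measure of the cube [x], when [w] is the measure of the atoms. *)
Definition mass w x : R := \sum_(y | le y x) w y.

Definition avg w g x : R := mass (fun y => g y * w y) x / mass w x.

(** The dyadic maximal function. *)
Definition maxf w g y : R := avg w g [arg max_(x > y | le y x) avg w g x]%O.

Lemma mass_ge0 w x : (forall y, 0 <= w y) -> 0 <= mass w x.
Proof. by move=> w0; apply: sumr_ge0. Qed.

Lemma avg_ge0 w g x : (forall y, 0 <= w y) -> (forall y, 0 <= g y) ->
  0 <= avg w g x.
Proof.
by move=> w0 g0; rewrite divr_ge0 ?mass_ge0// => y; rewrite mulr_ge0.
Qed.

(** True also for a cube of mass zero, all of whose atoms have weight zero. *)
Lemma mul_mass_avg w g x : (forall y, 0 <= w y) ->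
  mass w x * avg w g x = mass (fun y => g y * w y) x.
Proof.
move=> w0; have [S0|S0] := eqVneq (mass w x) 0; last by rewrite mulrC divfK.
rewrite S0 mul0r /mass big1// => y yx.
by rewrite [w y](_ : _ = 0) ?mulr0//; exact: (psumr_eq0P _ S0).
Qed.

Lemma avg_le_maxf w g x y : le y x -> avg w g x <= maxf w g y.
Proof. by rewrite /maxf; case: arg_maxP => // z _ h /h. Qed.

Lemma maxfP w g y : exists2 x, le y x & maxf w g y = avg w g x.
Proof.
rewrite /maxf; case: arg_maxP => [|z yz _]; first exact: le_refl.
by exists z.
Qed.

Lemma maxf_ge0 w g x : (forall y, 0 <= w y) -> (forall y, 0 <= g y) ->
  0 <= maxf w g x.
Proof. by move=> w0 g0; have [y _ ->] := maxfP w g x; exact: avg_ge0. Qed.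

Lemma maxf_anti w g x y : le x y -> maxf w g y <= maxf w g x.
Proof.
move=> xy; have [z yz ->] := maxfP w g y.
by apply: avg_le_maxf; exact: le_tr yz.
Qed.

(** A largest element above [x] that satisfies [P]: it is found by counting the
    elements below it. *)
Definition max_above (P : pred I) x :=
  [arg max_(y > x | P y && le x y) #|[set z | le z y]|].

Lemma max_aboveP (P : pred I) x : P x -> [/\ P (max_above P x),
  le x (max_above P x) & forall y, P y -> le (max_above P x) y -> y = max_above P x].
Proof.
rewrite /max_above => Px.
case: arg_maxnP => [|t /andP[Pt xt] tmax]; first by rewrite Px le_refl.
split=> // y Py ty; apply: le_asym; rewrite ty andbT.
have sub : [set z | le z t] \subset [set z | le z y].
  by apply/fintype.subsetP => z; rewrite !inE => zt; exact: le_tr ty.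
have : (#|[set z | le z y]| <= #|[set z | le z t]|)%N.
  by apply: tmax; rewrite Py (le_tr xt ty).
have [+ eqc] := subset_leqif_cards sub; rewrite leq_eqVlt ltnNge.
move=> + ge; rewrite ge orbF eqc => /eqP/setP/(_ y).
by rewrite !inE le_refl => ->.
Qed.

Section Top.
Variable b : I -> R.

Definition top x := max_above (fun y => b y == b x) x.

Lemma topP x : [/\ le x (top x), b (top x) = b x &
  forall y, le x y -> b y = b x -> le y (top x)].
Proof.
have [/eqP bt xt tmax] := @max_aboveP (fun y => b y == b x) x (eqxx _).
split=> // y xy byx; have /orP[//|ty] := le_forest xy xt.
by rewrite (tmax y _ ty) ?byx// le_refl.
Qed.

Lemma le_top x : le x (top x). Proof. by have [] := topP x. Qed.

Lemma b_top x : b (top x) = b x. Proof. by have [] := topP x. Qed.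

Lemma le_topP x y : le x y -> b y = b x -> le y (top x).
Proof. by have [_ _] := topP x; exact. Qed.

Lemma top_eq x y : le x y -> b y = b x -> top y = top x.
Proof.
move=> xy byx; have ytx := le_topP xy byx; apply: le_asym; apply/andP; split.
  by apply: le_topP; [exact: le_tr (le_top y)|rewrite b_top].
by apply: le_topP => //; rewrite b_top.
Qed.

Lemma top_idem x : top (top x) = top x.
Proof. by apply: top_eq; [exact: le_top|exact: b_top]. Qed.

End Top.

(** The maximal function rounded to a power of 2: cubes with the same level form
    the pieces of the stopping-time decomposition. *)
Definition level w g x : R := dyadic_floor (maxf w g x).

Lemma level_anti w g x y : le x y -> level w g y <= level w g x.
Proof. by move=> xy; apply/dyadic_floor_homo/maxf_anti. Qed.

(** The principal cube of [g] above [x]. *)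
Definition stop w g x := top (level w g) x.

(** If the average that realizes the maximal function at a principal cube were
    attained at a larger cube, that cube would have the same level and would be
    the principal one. *)
Lemma avg_stop w g x : stop w g x = x -> avg w g x = maxf w g x.
Proof.
move=> sx; have [y xy my] := maxfP w g x.
suff : le y x by move=> yx; rewrite my; congr avg; apply: le_asym; rewrite xy yx.
rewrite -[X in le _ X]sx; apply: le_topP => //; rewrite /level; congr (dyadic_floor _).
by apply/eqP; rewrite eq_le maxf_anti//= my avg_le_maxf.
Qed.

Definition carleson_const (p : R) : R :=
  2 * (geometric_const (p - 1) * 2 `^ (p - 1)).

(** If [x] is principal then its average is at least its level [b x], so the
    part of the integral of [g] over [x] on which [b x <= 2 * g] is at least
    half of [b x * mass w x].  Multiply by [b x `^ (p - 1)] and exchange the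
    sums: for a given [y], the principal cubes above [y] have distinct levels,
    all at most [2 * g y], and their powers form a geometric sum. *)
Lemma carleson_embedding w g p : 1 < p ->
  (forall y, 0 <= w y) -> (forall y, 0 <= g y) ->
  \sum_(x | stop w g x == x) level w g x `^ p * mass w x
    <= carleson_const p * \sum_y g y `^ p * w y.
Proof.
move=> p1 w0 g0; have p10 : 0 < p - 1 by rewrite subr_gt0.
have p0 : 0 < p by exact: lt_trans p1.
set b := level w g.
have b0 x : 0 <= b x by exact: dyadic_floor_ge0.
have step x : stop w g x == x -> b x `^ p * mass w x <=
    2 * (b x `^ (p - 1) * \sum_(y | le y x && (b x <= 2 * g y)) g y * w y).
  move=> /eqP/avg_stop ax.
  rewrite -(mulr_powRB1 (b0 x) p0) -mulrA mulrCA [leRHS]mulrCA ler_wpM2l ?powR_ge0//.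
  have : b x * mass w x <= mass (fun y => g y * w y) x.
    rewrite -mul_mass_avg// mulrC ler_wpM2l ?mass_ge0// ax.
    by rewrite dyadic_floor_le// maxf_ge0.
  rewrite /mass [X in _ <= X](bigID (fun y => b x <= 2 * g y))/=.
  set G := (X in X + _); set L := (X in _ + X) => H.
  have : 2 * L <= b x * mass w x.
    rewrite /L /mass !mulr_sumr [leRHS](bigID (fun y => b x <= 2 * g y))/=.
    rewrite -[leLHS]add0r lerD//; first by apply: sumr_ge0 => y _; rewrite mulr_ge0.
    apply: ler_sum => y /andP[_]; rewrite -ltNge => lt.
    by rewrite mulrA ler_wpM2r// ltW.
  rewrite [X in _ -> _ <= 2 * X](_ : _ = G) => [H2|]; last exact: eq_bigr.
  by move: H H2; rewrite /mass; lra.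
apply: (@le_trans _ _ (\sum_(x | stop w g x == x) 2 * (b x `^ (p - 1) *
    \sum_(y | le y x && (b x <= 2 * g y)) g y * w y))).
  by apply: ler_sum => x; exact: step.
rewrite -mulr_sumr /carleson_const -mulrA ler_wpM2l//.
under eq_bigr do rewrite mulr_sumr.
rewrite (exchange_big_dep xpredT)//= mulr_sumr; apply: ler_sum => y _.
rewrite -mulr_suml [leRHS](_ : _ =
    geometric_const (p - 1) * (2 * g y) `^ (p - 1) * (g y * w y)); last first.
  by rewrite -(mulr_powRB1 (g0 y))// powRM//; ring.
rewrite ler_wpM2r ?mulr_ge0//.
have -> : \sum_(x | [&& stop w g x == x, le y x & b x <= 2 * g y]) b x `^ (p - 1)
    = \sum_(x in [set x | [&& stop w g x == x, le y x & b x <= 2 * g y]])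
        b x `^ (p - 1).
  by apply: eq_bigl => x; rewrite inE.
apply: geometric_sum_le => //.
- by move=> x; rewrite inE b0 => /and3P[_ _ ->].
- move=> x x'; rewrite !inE => /and3P[/eqP sx yx _] /and3P[/eqP sx' yx' _] bxx'.
  have /orP[h|h] := le_forest yx yx'.
    by rewrite -sx -sx' /stop (top_eq h).
  by rewrite -sx -sx' /stop (top_eq h).
- by move=> x x'; exact: dyadic_floor_separated.
Qed.

Definition doob_const (p : R) : R := 2 `^ p * carleson_const p.

(** At [y] the maximal function is at most twice the level of the principal cube
    above [y], hence the Carleson embedding theorem applies. *)
Lemma doob_maximal w g p : 1 < p ->
  (forall y, 0 <= w y) -> (forall y, 0 <= g y) ->
  \sum_y maxf w g y `^ p * w y <= doob_const p * \sum_y g y `^ p * w y.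
Proof.
move=> p1 w0 g0; have p0 : 0 < p by exact: lt_trans p1.
rewrite /doob_const -mulrA.
apply: le_trans (ler_wpM2l (powR_ge0 _ _) (carleson_embedding p1 w0 g0)).
rewrite mulr_sumr.
have H y : maxf w g y `^ p * w y <= 2 `^ p * level w g (stop w g y) `^ p * w y.
  rewrite ler_wpM2r// -powRM ?dyadic_floor_ge0//.
  rewrite powR_le2r ?(ltW p0) ?maxf_ge0// b_top.
  by rewrite le_dyadic_floor// maxf_ge0.
apply: (@le_trans _ _ (\sum_y 2 `^ p * level w g (stop w g y) `^ p * w y)).
  by apply: ler_sum => y _; exact: H.
rewrite (partition_big (stop w g) (fun x => stop w g x == x))/=; last first.
  by move=> y _; rewrite /stop top_idem.
apply: ler_sum => x _.
have -> : 2 `^ p * (level w g x `^ p * mass w x) =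
    \sum_(y | le y x) 2 `^ p * level w g x `^ p * w y.
  by rewrite -mulr_sumr -/(mass w x) mulrA.
apply: ler_sum_sub => [y /eqP <-|y /eqP -> //|y _]; first exact: le_top.
by rewrite !mulr_ge0 ?powR_ge0.
Qed.

End Forest.

(** * The exponents *)

Section Exponents.
Variables (R : realType) (n : nat) (p : 'I_n.+1 -> R).

(** The exponents r_j enter through [theta j], which is 1 / r_j, and through
    [sexpo j], which is r_(j+1) / r_j. *)
Definition theta (j : nat) : R := 1 - \sum_(i < n.+1 | (i < j)%N) (p i)^-1.

Definition rexpo (j : nat) : R := (theta j)^-1.

Definition sexpo (j : nat) : R := rexpo j.+1 / rexpo j.

Hypothesis p_gt1 : forall i, 1 < p i.
Hypothesis p_sum : \sum_i (p i)^-1 < 1.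

Let p_gt0 i : 0 < p i. Proof. exact: lt_trans (p_gt1 i). Qed.

Lemma theta0 : theta 0 = 1.
Proof. by rewrite /theta big_pred0 ?subr0// => i; rewrite ltn0. Qed.

Lemma theta_max : theta n.+1 = 1 - \sum_i (p i)^-1.
Proof.
by rewrite /theta; congr (_ - _); apply: eq_bigl => i; rewrite ltn_ord.
Qed.

Lemma thetaS (j : 'I_n.+1) : theta j.+1 = theta j - (p j)^-1.
Proof.
rewrite /theta (bigD1 j) ?ltnSn//= opprD addrA addrAC; congr (_ - _ - _).
by apply: eq_bigl => i; rewrite ltnS ltn_neqAle andbC.
Qed.

Lemma theta_gt_sum j : \sum_(i < n.+1 | (j <= i)%N) (p i)^-1 < theta j.
Proof.
rewrite /theta ltrBrDr (le_lt_trans _ p_sum)//.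
rewrite [leRHS](bigID (fun i : 'I_n.+1 => (j <= i)%N))/= lerD2l.
by rewrite le_eqVlt (eq_bigl (fun i : 'I_n.+1 => ~~ (j <= i)%N)) ?eqxx// => i;
  rewrite ltnNge.
Qed.

Lemma theta_gt0 j : 0 < theta j.
Proof.
apply: le_lt_trans (theta_gt_sum j).
by apply: sumr_ge0 => i _; rewrite invr_ge0 ltW.
Qed.

Lemma theta_le1 j : theta j <= 1.
Proof. by rewrite gerBl; apply: sumr_ge0 => i _; rewrite invr_ge0 ltW. Qed.

(** The exponents p_i / r_j of the functions that are left after j steps are
    greater than 1, as the maximal theorem requires. *)
Lemma mul_theta_gt1 j (i : 'I_n.+1) : (j <= i)%N -> 1 < p i * theta j.
Proof.
move=> ji; rewrite -ltr_pdivrMl// mulr1; apply: le_lt_trans (theta_gt_sum j).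
rewrite (bigD1 i)//= lerDl.
by apply: sumr_ge0 => k _; rewrite invr_ge0 ltW.
Qed.

Lemma sexpoE j : sexpo j = theta j / theta j.+1.
Proof. by rewrite /sexpo /rexpo invrK mulrC. Qed.

Lemma sexpo_gt1 (j : 'I_n.+1) : 1 < sexpo j.
Proof.
by rewrite sexpoE ltr_pdivlMr ?theta_gt0// mul1r thetaS gtrBl invr_gt0.
Qed.

(** In step j the exponents p_j / r_j and r_(j+1) / r_j are conjugate. *)
Lemma mul_theta_conj (j : 'I_n.+1) : (p j * theta j)^-1 = 1 - (sexpo j)^-1.
Proof.
rewrite sexpoE invf_div thetaS.
have := theta_gt0 j; have := p_gt0 j => pj tj.
by field; rewrite !gt_eqF.
Qed.

Lemma sexpoB1_mul (j : 'I_n.+1) : (sexpo j - 1) * (p j * theta j) = sexpo j.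
Proof.
rewrite -[X in _ * X]invrK mul_theta_conj.
have := sexpo_gt1 j => s1; have s0 := lt_trans ltr01 s1.
field.
by rewrite (gt_eqF s0) subr_eq0 gt_eqF.
Qed.

Lemma invs_mul_theta (j : 'I_n.+1) i :
  (sexpo j)^-1 * (p i * theta j) = p i * theta j.+1.
Proof.
rewrite sexpoE invf_div; have := theta_gt0 j => tj.
by field; rewrite gt_eqF.
Qed.

Lemma rexpoS j : rexpo j * sexpo j = rexpo j.+1.
Proof.
by rewrite /sexpo mulrC divfK// /rexpo invr_eq0 gt_eqF// theta_gt0.
Qed.

Lemma prod_geS (V : comPzRingType) (F : 'I_n.+1 -> V) (j : 'I_n.+1) :
  \prod_(i < n.+1 | (j <= i)%N) F i = F j * \prod_(i < n.+1 | (j < i)%N) F i.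
Proof.
rewrite (bigD1 j)//=; congr (_ * _); apply: eq_bigl => i.
by rewrite ltn_neqAle andbC eq_sym.
Qed.

End Exponents.

(** * The maps K_j on a finite forest *)

Section Kernel.
Variables (R : realType) (I : finType) (le : rel I) (n : nat).
Variables (p : 'I_n.+1 -> R) (w : 'I_n.+1 -> I -> R) (k : I -> R).

Notation mass := (mass le).
Notation avg := (avg le).
Notation maxf := (maxf le).
Notation theta := (theta p).
Notation rexpo := (rexpo p).
Notation sexpo := (sexpo p).

(** The counterpart of [Kphi] for the identity permutation; other permutations
    are obtained by permuting [p] and [w].  When the mass of the cube is 0 the
    second factor makes the value 0. *)
Fixpoint Kdisc (j : nat) (x : I) : R :=
  if j is j'.+1 then
    Kdisc j' x * mass (w (inord j')) x * ((mass (w (inord j')) x)^-1 *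
      \sum_(y | le y x) Kdisc j' y * \prod_(i < n.+1 | (j' <= i)%N) mass (w i) y)
      `^ (sexpo j' - 1)
  else k x.

Hypotheses (le_refl : reflexive le) (le_asym : antisymmetric le).
Hypothesis le_tr : transitive le.
Hypothesis le_forest : forall x y z, le x y -> le x z -> le y z || le z y.
Hypothesis p_gt1 : forall i, 1 < p i.
Hypothesis p_sum : \sum_i (p i)^-1 < 1.
Hypotheses (w_ge0 : forall i x, 0 <= w i x) (k_ge0 : forall x, 0 <= k x).

Definition Kdisc_sum j x := \sum_(y | le y x)
  Kdisc j y * \prod_(i < n.+1 | (j <= i)%N) mass (w i) y.

Lemma KdiscS (j : 'I_n.+1) x : Kdisc j.+1 x =
  Kdisc j x * mass (w j) x * ((mass (w j) x)^-1 * Kdisc_sum j x) `^ (sexpo j - 1).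
Proof. by rewrite /= inord_val. Qed.

Lemma Kdisc_ge0 j x : 0 <= Kdisc j x.
Proof.
by elim: j x => [//|j IH] x /=; rewrite !mulr_ge0 ?powR_ge0// mass_ge0.
Qed.

Lemma Kdisc_sum_ge0 j x : 0 <= Kdisc_sum j x.
Proof.
apply: sumr_ge0 => y _; rewrite mulr_ge0 ?Kdisc_ge0//.
by apply: prodr_ge0 => i _; exact: mass_ge0.
Qed.

Lemma sum_mul_mass (c v : I -> R) :
  \sum_x c x * mass v x = \sum_y (\sum_(x | le y x) c x) * v y.
Proof.
under eq_bigr do rewrite /mass mulr_sumr.
by rewrite (exchange_big_dep xpredT)//=; apply: eq_bigr => y _; rewrite mulr_suml.
Qed.

Lemma le_avg_decreasing (v h : I -> R) y :
  (forall x, le x y -> h y <= h x) -> (forall x, 0 <= v x) -> 0 < v y ->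
  h y <= avg v h y.
Proof.
move=> hy v0 vy; rewrite ler_pdivlMr.
  by rewrite /mass mulr_sumr; apply: ler_sum => x xy; rewrite ler_wpM2r ?hy.
by rewrite /mass (bigD1 y)//= ltr_pwDl// sumr_ge0.
Qed.

Lemma mass_maxf_ge (v g : I -> R) e z x : 0 <= e -> (forall x, 0 <= v x) ->
  (forall x, 0 <= g x) -> le z x ->
  mass v z * avg v g x `^ e <= mass (fun y => maxf v g y `^ e * v y) z.
Proof.
move=> e0 v0 g0 zx; rewrite mulrC /mass mulr_sumr; apply: ler_sum => y yz.
rewrite ler_wpM2r// powR_le2r ?avg_ge0// avg_le_maxf//.
exact: le_tr zx.
Qed.

(** A function that decreases along inclusions is at most its own average over
    the cube of the point, except at atoms of weight zero. *)
Lemma sum_powR_le_maxf (v h : I -> R) s : 1 < s -> (forall x, 0 <= v x) ->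
  (forall x, 0 <= h x) -> (forall x y, le x y -> h y <= h x) ->
  \sum_y h y `^ s * v y <= \sum_y h y * maxf v h y `^ (s - 1) * v y.
Proof.
move=> s1 v0 h0 h_anti; apply: ler_sum => y _.
have := v0 y; rewrite le_eqVlt => /predU1P[<-|vy]; first by rewrite !mulr0.
rewrite ler_wpM2r// -(mulr_powRB1 (h0 y)) ?(lt_trans ltr01)// ler_wpM2l//.
rewrite powR_le2r ?subr_ge0 ?(ltW s1)//.
apply: (@le_trans _ _ (avg v h y)); last exact: avg_le_maxf.
by apply: le_avg_decreasing => // x; exact: h_anti.
Qed.

(** * From the embedding to the testing condition *)

Definition embedding_at j B := forall g : 'I_n.+1 -> I -> R,
  (forall i y, 0 <= g i y) ->
  \sum_x Kdisc j x * \prod_(i < n.+1 | (j <= i)%N) mass (fun y => g i y * w i y) x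
  <= B * \prod_(i < n.+1 | (j <= i)%N)
           (\sum_y g i y `^ (p i * theta j) * w i y) `^ (p i * theta j)^-1.

Definition step_const j : R :=
  (doob_const (sexpo j) `^ (1 - (sexpo j)^-1) * \prod_(i < n.+1 | (j < i)%N)
    doob_const (p i * theta j.+1) `^ (p i * theta j)^-1) `^ sexpo j.

(** Every maximal function in [F] and in the last factor is bounded below, on
    the cube [x], by the average over [x].  For [F] this yields the averages of
    the [g i] to the power [s^-1]; for [h] it yields the average over [x] of the
    part of [h] that comes from cubes inside [x], that is, the sum in the
    definition of [Kdisc j.+1 x] times the same averages.  The powers of the
    averages add up to 1. *)
Lemma KdiscS_prod_le (j : 'I_n.+1) (g : 'I_n.+1 -> I -> R) x :
  (forall i y, 0 <= g i y) ->
  let s := sexpo j in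
  let F i := mass (fun y => maxf (w i) (g i) y `^ s^-1 * w i y) in
  let c x := Kdisc j x * \prod_(i < n.+1 | (j < i)%N) F i x in
  let h y := \sum_(x | le y x) c x in
  (Kdisc j.+1 x * \prod_(i < n.+1 | (j < i)%N) mass (fun y => g i y * w i y) x
  <= c x * mass (fun y => maxf (w j) h y `^ (s - 1) * w j y) x : Prop).
Proof.
move=> g0 s F c h.
have s1 : 1 < s by exact: sexpo_gt1.
have s0 : 0 < s by exact: lt_trans s1.
have F0 i y : 0 <= F i y.
  by apply: mass_ge0 => z; rewrite mulr_ge0 ?powR_ge0.
have c0 y : 0 <= c y by rewrite mulr_ge0 ?Kdisc_ge0 ?prodr_ge0.
have h0 y : 0 <= h y by rewrite sumr_ge0.
have S0 i y : 0 <= mass (w i) y by exact: mass_ge0.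
have a0 i : 0 <= avg (w i) (g i) x by exact: avg_ge0.
pose P := \prod_(i < n.+1 | (j < i)%N) avg (w i) (g i) x `^ s^-1.
have P0 : 0 <= P by apply: prodr_ge0 => i _; exact: powR_ge0.
have PF z : le z x -> \prod_(i < n.+1 | (j < i)%N) mass (w i) z * P <=
    \prod_(i < n.+1 | (j < i)%N) F i z.
  move=> zx; rewrite -big_split/=; apply: ler_prod => i _.
  by rewrite mulr_ge0 ?powR_ge0//= mass_maxf_ge// invr_ge0 ltW.
have A : (mass (w j) x)^-1 * Kdisc_sum j x * P <= avg (w j) h x.
  rewrite /avg [leRHS]mulrC -mulrA ler_wpM2l ?invr_ge0//.
  have -> : mass (fun y => h y * w j y) x =
      \sum_z c z * \sum_(y | le y x && le y z) w j y.
    rewrite /mass; under eq_bigr do rewrite mulr_suml.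
    rewrite (exchange_big_dep xpredT)//=; apply: eq_bigr => z _.
    by rewrite mulr_sumr.
  rewrite /Kdisc_sum mulr_suml; apply: ler_sum_sub => // [z zx|z _]; last first.
    by rewrite mulr_ge0// sumr_ge0.
  rewrite /c -!mulrA ler_wpM2l ?Kdisc_ge0// prod_geS -mulrA mulrC.
  rewrite ler_pM ?mulr_ge0//; [by apply: prodr_ge0|exact: PF|].
  rewrite /mass le_eqVlt; apply/orP; left; apply/eqP/eq_bigl => y.
  by apply/idP/andP => [yz|[]//]; split=> //; exact: le_tr zx.
have -> : \prod_(i < n.+1 | (j < i)%N) mass (fun y => g i y * w i y) x =
    \prod_(i < n.+1 | (j < i)%N) mass (w i) x * (P * P `^ (s - 1)).
  rewrite mulr_powRB1// powR_prod => [|i _]; last exact: powR_ge0.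
  rewrite -big_split/=; apply: eq_bigr => i _.
  by rewrite -powRrM mulVf ?gt_eqF// powRr1// mul_mass_avg.
rewrite KdiscS -/s /c.
set Q := (\prod_(_ < _ | _) mass (w _) x).
set m := mass (w j) x; set t := m^-1 * _.
have t0 : 0 <= t by rewrite mulr_ge0 ?Kdisc_sum_ge0// invr_ge0 S0.
have Q0 : 0 <= Q by apply: prodr_ge0.
have -> : Kdisc j x * m * t `^ (s - 1) * (Q * (P * P `^ (s - 1))) =
    Kdisc j x * (Q * P) * (m * (t * P) `^ (s - 1)).
  by rewrite (powRM _ t0 P0); ring.
apply: ler_pM.
- by rewrite !mulr_ge0 ?Kdisc_ge0.
- by rewrite !mulr_ge0 ?powR_ge0// S0.
- by rewrite ler_wpM2l ?Kdisc_ge0// PF.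
- have s10 : 0 <= s - 1 by rewrite subr_ge0 ltW.
  apply: (le_trans _ (mass_maxf_ge s10 _ _ (le_refl x))) => //.
  by rewrite ler_wpM2l ?S0// powR_le2r// mulr_ge0.
Qed.

(** Let [X] be the form at the functions [f].  Since [h] is at most its maximal
    function, [X] bounds the s-th power integral of [h], so the maximal theorem
    bounds the norm of [f j] by a power of [X] below 1; [self_improve] removes
    it. *)
Lemma embedding_atS (j : 'I_n.+1) B : 0 <= B -> embedding_at j B ->
  embedding_at j.+1 (step_const j * B `^ sexpo j).
Proof.
move=> B0 EB g g0; set s := sexpo j.
have s1 : 1 < s by exact: sexpo_gt1.
have s0 : 0 < s by exact: lt_trans s1.
pose F i := mass (fun y => maxf (w i) (g i) y `^ s^-1 * w i y).
pose c x := Kdisc j x * \prod_(i < n.+1 | (j < i)%N) F i x.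
pose h y := \sum_(x | le y x) c x.
pose X := \sum_x c x * mass (fun y => maxf (w j) h y `^ (s - 1) * w j y) x.
apply: (@le_trans _ _ X).
  by apply: ler_sum => x _; exact: KdiscS_prod_le.
have F0 i y : 0 <= F i y.
  by apply: mass_ge0 => z; rewrite mulr_ge0 ?powR_ge0.
have c0 y : 0 <= c y by rewrite mulr_ge0 ?Kdisc_ge0 ?prodr_ge0.
have h0 y : 0 <= h y by rewrite sumr_ge0.
have X0 : 0 <= X.
  apply: sumr_ge0 => x _; rewrite mulr_ge0// mass_ge0// => y.
  by rewrite mulr_ge0 ?powR_ge0.
have hX : \sum_y h y `^ s * w j y <= X.
  rewrite /X sum_mul_mass; under [leRHS]eq_bigr do rewrite mulrA.
  apply: sum_powR_le_maxf => // x y xy.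
  by apply: ler_sum_sub => // z; exact: le_tr.
pose Y i := \sum_y g i y `^ (p i * theta j.+1) * w i y.
have Y0 i : 0 <= Y i by apply: sumr_ge0 => y _; rewrite mulr_ge0 ?powR_ge0.
have doob0 q : 1 < q -> 0 <= doob_const q :> R.
  move=> q1; rewrite !mulr_ge0 ?powR_ge0 ?geometric_const_ge0 ?subr_gt0//.
pose Z := B * (doob_const s `^ (1 - s^-1) * \prod_(i < n.+1 | (j < i)%N)
  (doob_const (p i * theta j.+1) * Y i) `^ (p i * theta j)^-1).
have ZX : X <= Z * X `^ (1 - s^-1).
  (* f_j = (M h)^(s-1) and f_i = (M g_i)^(1/s) for i > j *)
  pose f i y := if i == j then maxf (w j) h y `^ (s - 1)
                else maxf (w i) (g i) y `^ s^-1.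
  have f0 i y : 0 <= f i y by rewrite /f; case: ifP => _; exact: powR_ge0.
  have XE : X = \sum_x Kdisc j x * \prod_(i < n.+1 | (j <= i)%N)
      mass (fun y => f i y * w i y) x.
    apply: eq_bigr => x _; rewrite prod_geS /c -mulrA; congr (_ * _).
    rewrite mulrC; congr (_ * _).
      by apply: eq_bigr => y _; rewrite /f eqxx.
    apply: eq_bigr => i; rewrite ltn_neqAle eq_sym => /andP[/negbTE ij _].
    by apply: eq_bigr => y _; rewrite /f -val_eqE/= ij.
  rewrite {1}XE; apply: (le_trans (EB f f0)).
  rewrite prod_geS /Z -mulrA ler_wpM2l// mulrAC.
  apply: ler_pM; rewrite ?powR_ge0//.
  - by apply: prodr_ge0 => i _; exact: powR_ge0.
  - rewrite mul_theta_conj// -powRM ?doob0//.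
    have s'0 : 0 <= 1 - s^-1 by rewrite subr_ge0 invf_le1 ?(ltW s1).
    apply: powR_le2r => //.
      by apply: sumr_ge0 => y _; rewrite mulr_ge0 ?powR_ge0.
    apply: (le_trans _ (ler_wpM2l (doob0 _ s1) hX)).
    apply: le_trans (doob_maximal le_refl le_asym le_tr le_forest s1 _ _) => //.
    by apply: ler_sum => y _; rewrite /f eqxx -powRrM sexpoB1_mul.
  - apply: ler_prod => i ji; rewrite powR_ge0/=.
    have pj : 1 < p i * theta j by exact/mul_theta_gt1/ltnW.
    have pj1 : 1 < p i * theta j.+1 by exact: mul_theta_gt1.
    apply: powR_le2r.
    + by rewrite invr_ge0 (ltW (lt_trans _ pj)).
    + by apply: sumr_ge0 => y _; rewrite mulr_ge0 ?powR_ge0.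
    apply: le_trans (doob_maximal le_refl le_asym le_tr le_forest pj1 _ _) => //.
    apply: ler_sum => y _; rewrite /f; move: ji; rewrite ltn_neqAle eq_sym.
    by move=> /andP[/negbTE ij _]; rewrite -val_eqE/= ij -powRrM invs_mul_theta.
have D0 : 0 <= \prod_(i < n.+1 | (j < i)%N)
    doob_const (p i * theta j.+1) `^ (p i * theta j)^-1.
  by apply: prodr_ge0 => i _; exact: powR_ge0.
have Z0 : 0 <= Z.
  rewrite !mulr_ge0 ?powR_ge0//.
  by apply: prodr_ge0 => i _; exact: powR_ge0.
apply: (le_trans (self_improve s0 X0 Z0 ZX)).
rewrite /Z /step_const.
have -> : \prod_(i < n.+1 | (j < i)%N)
    (doob_const (p i * theta j.+1) * Y i) `^ (p i * theta j)^-1 =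
  (\prod_(i < n.+1 | (j < i)%N) doob_const (p i * theta j.+1) `^ (p i * theta j)^-1)
  * \prod_(i < n.+1 | (j < i)%N) Y i `^ (p i * theta j)^-1.
  rewrite -big_split/=; apply: eq_bigr => i ji; rewrite powRM// doob0//.
  exact: mul_theta_gt1.
have Y'0 : 0 <= \prod_(i < n.+1 | (j < i)%N) Y i `^ (p i * theta j)^-1.
  by apply: prodr_ge0 => i _; exact: powR_ge0.
rewrite [X in X `^ s <= _](_ : _ = (doob_const s `^ (1 - s^-1) *
  \prod_(i < n.+1 | (j < i)%N) doob_const (p i * theta j.+1) `^ (p i * theta j)^-1)
  * B * \prod_(i < n.+1 | (j < i)%N) Y i `^ (p i * theta j)^-1); last by ring.
rewrite powRM ?mulr_ge0 ?powR_ge0// powRM ?mulr_ge0 ?powR_ge0//.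
rewrite ler_wpM2l ?mulr_ge0 ?powR_ge0//.
rewrite powR_prod => [|i _]; last exact: powR_ge0.
rewrite le_eqVlt; apply/orP; left; apply/eqP; apply: eq_bigr => i ji.
rewrite -powRrM; congr (_ `^ _).
by rewrite -(invs_mul_theta p_gt1 p_sum) [RHS]invfM invrK mulrC.
Qed.

Fixpoint necessity_const j : R :=
  if j is j'.+1 then
    step_const j' * necessity_const j' `^ sexpo j'
  else 1.

Lemma necessity_const_ge0 j : 0 <= necessity_const j.
Proof. by elim: j => //= j IH; rewrite mulr_ge0 ?powR_ge0. Qed.

Lemma embedding_at_all c j : (j <= n.+1)%N -> 0 <= c -> embedding_at 0 c ->
  embedding_at j (necessity_const j * c `^ rexpo j).
Proof.
move=> + c0 E0; elim: j => [_|j IH jn].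
  by rewrite /rexpo theta0 invr1 mul1r powRr1.
have NC0 := necessity_const_ge0 j.
have -> : necessity_const j.+1 * c `^ rexpo j.+1 =
    step_const j * (necessity_const j * c `^ rexpo j) `^ sexpo j.
  by rewrite powRM ?powR_ge0// -powRrM rexpoS//= -mulrA.
apply: (@embedding_atS (Ordinal jn)); last exact/IH/ltnW.
by rewrite mulr_ge0 ?powR_ge0.
Qed.

(** The r-th power of the norm in the testing condition. *)
Definition testing_sum : R :=
  \sum_y (\sum_(x | le y x) Kdisc n x) `^ sexpo n * w ord_max y.

(** Duality: the form is tested on [h `^ (s - 1)]. *)
Lemma testing_sum_le B : 0 <= B -> embedding_at n B -> testing_sum <= B `^ sexpo n.
Proof.
move=> B0 EB; set s := sexpo n.
have s1 : 1 < s := sexpo_gt1 p_gt1 p_sum ord_max.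
have s0 : 0 < s by exact: lt_trans s1.
pose h y := \sum_(x | le y x) Kdisc n x.
have h0 y : 0 <= h y by apply: sumr_ge0 => x _; exact: Kdisc_ge0.
apply: self_improve => //.
  by apply: sumr_ge0 => y _; rewrite mulr_ge0 ?powR_ge0.
have := EB (fun _ y => h y `^ (s - 1)) (fun _ _ => powR_ge0 _ _).
have one (F : 'I_n.+1 -> R) :
    \prod_(i < n.+1 | (n <= i)%N) F i = F ord_max.
  by rewrite (prod_geS _ ord_max) big_pred0 ?mulr1// => i;
    rewrite ltnNge -ltnS ltn_ord.
under eq_bigr do rewrite one.
rewrite one sum_mul_mass (mul_theta_conj p_gt1 p_sum ord_max) -/s.
congr (_ <= _ * _ `^ _); apply: eq_bigr => y _.
  by rewrite mulrA mulr_powRB1 ?h0.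
by rewrite -powRrM (sexpoB1_mul p_gt1 p_sum ord_max).
Qed.

(** * From the testing condition to the embedding *)

(** Pairwise incomparable cubes have no common atom. *)
Lemma sum_antichain_mass_le (v : I -> R) (M : pred I) F :
  (forall x, 0 <= v x) -> (forall x, M x -> le x F) ->
  (forall x y, M x -> M y -> le x y -> x = y) ->
  \sum_(x | M x) mass v x <= mass v F.
Proof.
move=> v0 MF Manti; rewrite /mass (exchange_big_dep xpredT)//=.
rewrite [leRHS]big_mkcond/=; apply: ler_sum => y _.
case: (pickP (fun x => M x && le y x)) => [x /andP[Mx yx]|none]; last first.
  by rewrite big_pred0//; case: ifP.
rewrite (le_tr yx (MF _ Mx)) (big_pred1 x)// => z /=.
apply/idP/eqP => [/andP[Mz yz]|->]; last by rewrite Mx.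
have /orP[h|h] := le_forest yx yz; first by rewrite (Manti _ _ Mx Mz h).
exact: Manti.
Qed.

(** Let L be the left-hand sum and t = L / (2 * mass v F).  Call [x] bad if the
    quotient on the right is less than t at [x].  Every bad cube
    lies below a maximal bad cube, and these are pairwise incomparable, so the
    bad cubes carry at most [t * mass v F], half of L.  The other cubes carry
    the other half, and for them the factor on the right is at least
    [t `^ (s - 1)]. *)
Lemma local_testing (v lam : I -> R) (P : {set I}) F s : 1 < s ->
  (forall x, 0 <= v x) -> (forall x, 0 <= lam x) ->
  (forall x, mass v x = 0 -> lam x = 0) ->
  (forall x, x \in P -> le x F) ->
  (\sum_(x in P) lam x) `^ s <= 2 `^ s * mass v F `^ (s - 1) *
    \sum_(x in P) lam x * ((mass v x)^-1 * \sum_(y in P | le y x) lam y) `^ (s - 1).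
Proof.
move=> s1 v0 lam0 vlam PF; have s0 : 0 < s by exact: lt_trans s1.
set L := \sum_(x in P) lam x; set S := mass v F.
pose Lam x := \sum_(y in P | le y x) lam y.
have S_mono x y : le x y -> mass v x <= mass v y.
  by move=> xy; apply: ler_sum_sub => // z zx; exact: le_tr xy.
have Lam0 x : 0 <= Lam x by apply: sumr_ge0.
have S0 x : 0 <= mass v x by exact: mass_ge0.
have L0 : 0 <= L by apply: sumr_ge0.
have R0 : 0 <= \sum_(x in P) lam x * ((mass v x)^-1 * Lam x) `^ (s - 1).
  by apply: sumr_ge0 => x _; rewrite mulr_ge0 ?powR_ge0.
have [LE|Lneq0] := eqVneq L 0.
  by rewrite LE powR0 ?gt_eqF// !mulr_ge0 ?powR_ge0.
have {Lneq0} Lgt0 : 0 < L by rewrite lt_neqAle eq_sym Lneq0.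
have Sgt0 : 0 < S.
  rewrite lt_neqAle eq_sym S0 andbT; apply/eqP => SE.
  move: Lgt0; rewrite /L big1 ?ltxx// => x xP; apply: vlam.
  by apply/eqP; rewrite eq_le S0 andbT -SE S_mono ?PF.
pose t := L / 2 / S.
have t0 : 0 < t by rewrite !divr_gt0.
pose bad x := (x \in P) && ((mass v x)^-1 * Lam x < t).
pose maxbad M := bad M && [forall y, bad y && le M y ==> (y == M)].
have badP x : bad x -> exists2 M, maxbad M & le x M.
  move=> bx; have [bM xM Mmax] := max_aboveP le_refl le_asym le_tr bx.
  exists (max_above le bad x) => //; rewrite /maxbad bM; apply/forallP => y.
  by apply/implyP => /andP[bad_y My]; apply/eqP/Mmax.
have bad_le : \sum_(x | bad x) lam x <= L / 2.
  apply: (@le_trans _ _ (\sum_(M | maxbad M) Lam M)).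
    rewrite /Lam (exchange_big_dep (fun x => x \in P))/=; last first.
      by move=> M x _ /andP[].
    apply: ler_sum_sub => x.
    - by move=> /andP[].
    - move=> bx; have [M mM xM] := badP x bx.
      rewrite (bigD1 M)/=; last by rewrite mM xM; case/andP: bx => ->.
      by rewrite lerDl sumr_ge0.
    - by move=> _; rewrite sumr_ge0.
  apply: (@le_trans _ _ (\sum_(M | maxbad M) t * mass v M)).
    apply: ler_sum => M /andP[/andP[MP /ltW lt] _].
    have [SM|SM] := eqVneq (mass v M) 0.
      rewrite SM mulr0 /Lam big1// => y /andP[_ yM]; apply: vlam.
      by apply/eqP; rewrite eq_le S0 andbT -SM S_mono.
    rewrite -ler_pdivrMr; first by rewrite mulrC.
    by rewrite lt_neqAle eq_sym SM S0.
  have -> : L / 2 = t * S by rewrite /t divfK// gt_eqF.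
  rewrite -mulr_sumr ler_wpM2l ?(ltW t0)//; apply: sum_antichain_mass_le => //.
    by move=> x /andP[/andP[xP _] _]; exact: PF.
  move=> x y /andP[_ /forallP/(_ y)/implyP mx] /andP[by_ _] xy.
  by apply/esym/eqP/mx; rewrite by_.
have good_ge : L / 2 <= \sum_(x in P | t <= (mass v x)^-1 * Lam x) lam x.
  have : L = \sum_(x in P | t <= (mass v x)^-1 * Lam x) lam x +
             \sum_(x | bad x) lam x.
    rewrite /L (bigID (fun x => t <= (mass v x)^-1 * Lam x))/=; congr (_ + _).
    by apply: eq_bigl => x; rewrite /bad ltNge.
  by move: bad_le; lra.
have -> : L `^ s = 2 `^ s * S `^ (s - 1) * (L / 2 * t `^ (s - 1)).
  have tE : L / 2 = S * t by rewrite /t mulrCA mulfV ?mulr1// gt_eqF.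
  rewrite -mulrA [X in _ = _ * X](_ : _ = (L / 2) * (L / 2) `^ (s - 1)); last first.
    have -> : (L / 2) `^ (s - 1) = S `^ (s - 1) * t `^ (s - 1).
      by rewrite tE (powRM _ (ltW Sgt0) (ltW t0)).
    by ring.
  by rewrite mulr_powRB1 ?divr_ge0// -powRM ?divr_ge0// mulrC divfK.
rewrite ler_wpM2l ?mulr_ge0 ?powR_ge0//.
apply: (@le_trans _ _ (\sum_(x in P | t <= (mass v x)^-1 * Lam x) lam x * t `^ (s - 1))).
  by rewrite -mulr_suml ler_wpM2r ?powR_ge0.
apply: ler_sum_sub => [x /andP[]//|x /andP[_ tx]|x _].
  by rewrite ler_wpM2l// powR_le2r ?(ltW t0)// subr_ge0 ltW.
by rewrite mulr_ge0 ?powR_ge0.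
Qed.

(** The term of index [x] in the embedding with the kernel of step [j], for
    the constant functions 1 in the variables that are left. *)
Definition Kdisc_term j x := Kdisc j x * \prod_(i < n.+1 | (j <= i)%N) mass (w i) x.

Lemma Kdisc_term_ge0 j x : 0 <= Kdisc_term j x.
Proof.
by rewrite mulr_ge0 ?Kdisc_ge0//; apply: prodr_ge0 => i _; exact: mass_ge0.
Qed.

Lemma Kdisc_termS (j : 'I_n.+1) x : Kdisc_term j.+1 x =
  Kdisc_term j x * ((mass (w j) x)^-1 * Kdisc_sum j x) `^ (sexpo j - 1).
Proof. by rewrite /Kdisc_term KdiscS prod_geS; ring. Qed.

(** [tau i x] plays the part of the principal cube above [x] in the [i]-th
    variable and [beta i] that of the average there; [X] is a set of cubes whose
    principal cubes are sorted, so that the [i]-th one determines the next. *)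
Section Nested.
Variables (tau : 'I_n.+1 -> I -> I) (beta : 'I_n.+1 -> I -> R) (X : {set I}).
Hypothesis le_tau : forall i x, le x (tau i x).
Hypothesis tau_nested : forall (i i' : 'I_n.+1) x y, x \in X -> y \in X ->
  (i <= i')%N -> tau i x = tau i y -> tau i' x = tau i' y.
Hypothesis beta_ge0 : forall i x, 0 <= beta i x.

Definition carleson_sum i (P : {set I}) :=
  \sum_(F in [set tau i x | x in P]) beta i F `^ p i * mass (w i) F.

Lemma carleson_sum_ge0 i P : 0 <= carleson_sum i P.
Proof. by apply: sumr_ge0 => F _; rewrite mulr_ge0 ?powR_ge0// mass_ge0. Qed.

Definition nested_bound j := forall P : {set I}, P \subset X ->
  \sum_(x in P) Kdisc_term 0 x * \prod_(i < n.+1 | (i < j)%N) beta i (tau i x)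
  <= 2 ^+ j * (\prod_(i < n.+1 | (i < j)%N) carleson_sum i P `^ (p i)^-1 *
               (\sum_(x in P) Kdisc_term j x) `^ theta j).

Lemma nested_bound0 : nested_bound 0.
Proof.
move=> P _; rewrite expr0 mul1r [X in _ <= X * _]big_pred0// mul1r theta0 powRr1; last first.
  by apply: sumr_ge0 => x _; exact: Kdisc_term_ge0.
by apply: ler_sum => x _; rewrite big_pred0 ?mulr1.
Qed.

Lemma prod_ltS (F : 'I_n.+1 -> R) (j : 'I_n.+1) :
  \prod_(i < n.+1 | (i < j.+1)%N) F i = F j * \prod_(i < n.+1 | (i < j)%N) F i.
Proof.
rewrite (bigD1 j)//=; congr (_ * _); apply: eq_bigl => i.
by rewrite ltnS ltn_neqAle andbC.
Qed.

(** Split [P] into the blocks [Q F] on which [tau j] is constant, apply the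
    induction hypothesis and [local_testing] to each block, and sum over the
    blocks by Hoelder's inequality with the exponents [p i] for [i <= j] and
    [rexpo j.+1].  No principal cube of a variable [i <= j] is counted in two
    blocks, as it determines the block. *)
Lemma nested_boundS (j : 'I_n.+1) : nested_bound j -> nested_bound j.+1.
Proof.
move=> Ej P PX; pose Q F := [set x in P | tau j x == F].
have QP F : Q F \subset P by apply/fintype.subsetP => x; rewrite inE => /andP[].
set s := sexpo j; have s1 : 1 < s by exact: sexpo_gt1.
have tj := theta_gt0 p_gt1 p_sum j; have tj1 := theta_gt0 p_gt1 p_sum j.+1.
have pj0 : 0 < p j by exact: lt_trans (p_gt1 j).
have kt0 i (P' : {set I}) : 0 <= \sum_(x in P') Kdisc_term i x.
  by apply: sumr_ge0 => x _; exact: Kdisc_term_ge0.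
have m0 i x : 0 <= mass (w i) x by exact: mass_ge0.
have block F : \sum_(x in Q F) Kdisc_term 0 x * \prod_(i < n.+1 | (i < j.+1)%N) beta i (tau i x)
    <= 2 ^+ j.+1 * (\prod_(i < n.+1 | (i < j.+1)%N) carleson_sum i (Q F) `^ (p i)^-1 *
               (\sum_(x in Q F) Kdisc_term j.+1 x) `^ theta j.+1).
  have [->|/set0Pn[x0 x0Q]] := eqVneq (Q F) finset.set0.
    rewrite big_set0 !mulr_ge0 ?exprn_ge0 ?powR_ge0//.
    by apply: prodr_ge0 => i _; exact: powR_ge0.
  have -> : \sum_(x in Q F) Kdisc_term 0 x * \prod_(i < n.+1 | (i < j.+1)%N) beta i (tau i x)
     = beta j F * \sum_(x in Q F) Kdisc_term 0 x * \prod_(i < n.+1 | (i < j)%N) beta i (tau i x).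
    rewrite mulr_sumr; apply: eq_bigr => x; rewrite inE => /andP[_ /eqP xF].
    by rewrite prod_ltS xF; ring.
  have CE : carleson_sum j (Q F) = beta j F `^ p j * mass (w j) F.
    rewrite /carleson_sum (_ : [set _ | _ in _] = [set F]) ?big_set1//.
    apply/setP => G; rewrite inE; apply/imsetP/eqP => [[x]|->].
      by rewrite inE => /andP[_ /eqP <-].
    by exists x0 => //; move: x0Q; rewrite inE => /andP[_ /eqP].
  have bA : beta j F * (\sum_(x in Q F) Kdisc_term j x) `^ theta j <=
      2 * (carleson_sum j (Q F) `^ (p j)^-1 *
           (\sum_(x in Q F) Kdisc_term j.+1 x) `^ theta j.+1).
    rewrite CE powRM ?powR_ge0// -powRrM mulfV ?gt_eqF// powRr1//.
    rewrite [leRHS](_ : _ = beta j F * (2 * (mass (w j) F `^ (p j)^-1 *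
      (\sum_(x in Q F) Kdisc_term j.+1 x) `^ theta j.+1))); last by ring.
    rewrite ler_wpM2l//.
    have loc : (\sum_(x in Q F) Kdisc_term j x) `^ s <=
        2 `^ s * mass (w j) F `^ (s - 1) * \sum_(x in Q F) Kdisc_term j.+1 x.
      have := @local_testing (w j) (Kdisc_term j) (Q F) F s s1 (w_ge0 j) (Kdisc_term_ge0 j) _ _.
      move=> /(_ _)/wrap[].
        by move=> x mx; rewrite /Kdisc_term prod_geS mx mul0r mulr0.
      move=> /(_ _)/wrap[].
        by move=> x; rewrite inE => /andP[_ /eqP <-]; exact: le_tau.
      move=> h; apply: (le_trans h).
      rewrite ler_wpM2l ?mulr_ge0 ?powR_ge0//; apply: ler_sum => x _.
      rewrite Kdisc_termS ler_wpM2l ?Kdisc_term_ge0// powR_le2r ?subr_ge0 ?(ltW s1)//.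
        by rewrite mulr_ge0 ?invr_ge0// sumr_ge0// => y _; exact: Kdisc_term_ge0.
      rewrite ler_wpM2l ?invr_ge0//; apply: ler_sum_sub => [y /andP[]//|//|y _].
      exact: Kdisc_term_ge0.
    have sE : s * theta j.+1 = theta j by rewrite /s sexpoE divfK// gt_eqF.
    have pE : (s - 1) * theta j.+1 = (p j)^-1.
      by rewrite mulrBl sE mul1r thetaS opprB addrCA subrr addr0.
    have := powR_le2r (ltW tj1) (powR_ge0 _ _) loc.
    rewrite -powRrM sE powRM ?mulr_ge0 ?powR_ge0//.
    rewrite powRM ?mulr_ge0 ?powR_ge0// -!powRrM sE pE => h; apply: (le_trans h).
    rewrite -mulrA ler_wpM2r ?mulr_ge0 ?powR_ge0//.
    by rewrite -[leRHS]powRr1// ler_powR ?ler1n// theta_le1.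
  apply: (@le_trans _ _ (beta j F * (2 ^+ j *
      (\prod_(i < n.+1 | (i < j)%N) carleson_sum i (Q F) `^ (p i)^-1 *
               (\sum_(x in Q F) Kdisc_term j x) `^ theta j)))).
    by rewrite ler_wpM2l// Ej// (fintype.subset_trans (QP F)).
  rewrite prod_ltS exprS.
  set Pr := (\prod_(_ < _ | _) _); set A := _ `^ theta j; set A' := _ `^ theta j.+1.
  rewrite [leLHS](_ : _ = 2 ^+ j * Pr * (beta j F * A)); last by ring.
  rewrite [leRHS](_ : _ = 2 ^+ j * Pr *
    (2 * (carleson_sum j (Q F) `^ (p j)^-1 * A'))); last by ring.
  rewrite ler_wpM2l// mulr_ge0 ?exprn_ge0//.
  by apply: prodr_ge0 => i _; exact: powR_ge0.
rewrite (partition_big (tau j) predT)//=.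
apply: (@le_trans _ _ (\sum_F 2 ^+ j.+1 *
   (\prod_(i < n.+1 | (i < j.+1)%N) carleson_sum i (Q F) `^ (p i)^-1 *
               (\sum_(x in Q F) Kdisc_term j.+1 x) `^ theta j.+1))).
  apply: ler_sum => F _; apply: le_trans (block F).
  by rewrite le_eqVlt; apply/orP; left; apply/eqP/eq_bigl => x; rewrite inE.
rewrite -mulr_sumr ler_wpM2l ?exprn_ge0//.
(* [None] stands for the factor that contains the kernel *)
pose e (o : option 'I_n.+1) := if o is Some i then
  (if (i < j.+1)%N then (p i)^-1 else 0) else theta j.+1.
pose f (o : option 'I_n.+1) F := if o is Some i then carleson_sum i (Q F)
  else \sum_(x in Q F) Kdisc_term j.+1 x.
have fE (g : 'I_n.+1 -> R) : \prod_i g i `^ e (Some i) =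
    \prod_(i < n.+1 | (i < j.+1)%N) g i `^ (p i)^-1.
  rewrite [RHS]big_mkcond/=; apply: eq_bigr => i _.
  by case: ifP => // _; rewrite powRr0.
have hE F : \prod_o f o F `^ e o =
    \prod_(i < n.+1 | (i < j.+1)%N) carleson_sum i (Q F) `^ (p i)^-1 *
    (\sum_(x in Q F) Kdisc_term j.+1 x) `^ theta j.+1.
  by rewrite big_option/= mulrC -fE.
apply: (@le_trans _ _ (\sum_F \prod_o f o F `^ e o)).
  by apply: ler_sum => F _; rewrite hE.
apply: (@le_trans _ _ (\prod_o (\sum_F f o F) `^ e o)).
  apply: hoelder_prod => [[i|]||[i|] F] /=.
  - by case: ifP => // _; rewrite invr_ge0 (ltW (lt_trans _ (p_gt1 i))).
  - exact: ltW.
  - by rewrite big_option/= -big_mkcond/= subrK.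
  - exact: carleson_sum_ge0.
  - exact: kt0.
rewrite big_option/= mulrC (fE (fun i => \sum_F carleson_sum i (Q F))).
apply: ler_pM; rewrite ?powR_ge0//.
- by apply: prodr_ge0 => i _; exact: powR_ge0.
- apply: ler_prod => i ij; rewrite powR_ge0/=; apply: powR_le2r.
  + by rewrite invr_ge0 (ltW (lt_trans _ (p_gt1 i))).
  + by apply: sumr_ge0 => F _; exact: carleson_sum_ge0.
  rewrite /carleson_sum (exchange_big_dep (mem [set tau i x | x in P]))/=; last first.
    by move=> F G _; apply: fintype.subsetP; exact: imsetS.
  apply: ler_sum => G GP; have /imsetP[x xP Gx] := GP.
  rewrite (big_pred1 (tau j x))// => F /=; apply/imsetP/eqP => [[y]|->].
    rewrite inE => /andP[yP /eqP <-] Gy.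
    apply: (tau_nested _ _ ij); rewrite -?Gx//; exact: (fintype.subsetP PX).
  by exists x; rewrite // inE xP eqxx.
- rewrite le_eqVlt; apply/orP; left; apply/eqP; congr (_ `^ _).
  rewrite [RHS](partition_big (tau j) predT)//=; apply: eq_bigr => F _.
  by apply: eq_bigl => x; rewrite inE.
Qed.

Lemma nested_bound_all j : (j <= n.+1)%N -> nested_bound j.
Proof.
elim: j => [_|j IH jn]; first exact: nested_bound0.
exact: (@nested_boundS (Ordinal jn) (IH (ltnW jn))).
Qed.

End Nested.

Definition embedding_discrete c := forall g : 'I_n.+1 -> I -> R,
  (forall i y, 0 <= g i y) ->
  \sum_x k x * \prod_i mass (fun y => g i y * w i y) x
  <= c * \prod_i (\sum_y g i y `^ p i * w i y) `^ (p i)^-1.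

Lemma embedding_discrete_testing c : 0 <= c -> embedding_discrete c ->
  testing_sum <= (necessity_const n `^ theta n * c) `^ rexpo n.+1.
Proof.
move=> c0 Ec.
have E0 : embedding_at 0 c.
  move=> g g0; apply: (le_trans (Ec g g0)); rewrite theta0.
  rewrite [X in _ <= c * X](eq_bigr (fun i =>
    (\sum_y g i y `^ p i * w i y) `^ (p i)^-1)) => [|i _]; first exact: lexx.
  by rewrite mulr1.
have B0 : 0 <= necessity_const n * c `^ rexpo n.
  by rewrite mulr_ge0 ?powR_ge0// necessity_const_ge0.
apply: (le_trans (testing_sum_le B0 (embedding_at_all (leqnSn n) c0 E0))).
rewrite !powRM ?powR_ge0 ?necessity_const_ge0//.
by rewrite -!powRrM (rexpoS p_gt1 p_sum) sexpoE.
Qed.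

(** The sum over the cubes inside [x], divided by the mass of [x], is at most the
    average over [x] of the function h in [testing_sum], so the left-hand side
    is at most the integral of h (M h)^(s-1), and the maximal theorem applies. *)
Lemma sum_Kdisc_le_testing :
  \sum_x Kdisc_term n.+1 x <= doob_const (sexpo n) * testing_sum.
Proof.
have s1 : 1 < sexpo n := sexpo_gt1 p_gt1 p_sum ord_max.
have s0 : 0 < sexpo n by exact: lt_trans s1.
have one (i : 'I_n.+1) : (n < i)%N = false by rewrite ltnNge -ltnS ltn_ord.
have prod1 (F : 'I_n.+1 -> R) : \prod_(i < n.+1 | (n < i)%N) F i = 1.
  by apply: big_pred0 => i; exact: one.
have prod1' (F : 'I_n.+1 -> R) :
  \prod_(i < n.+1 | ((ord_max : 'I_n.+1) < i)%N) F i = 1 by exact: prod1.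
pose h y := \sum_(x | le y x) Kdisc n x.
have h0 y : 0 <= h y by apply: sumr_ge0 => x _; exact: Kdisc_ge0.
apply: (@le_trans _ _ (\sum_x Kdisc n x *
    mass (fun y => maxf (w ord_max) h y `^ (sexpo n - 1) * w ord_max y) x)).
  apply: ler_sum => x _.
  have := @KdiscS_prod_le ord_max (fun _ _ => 0) x (fun _ _ => lexx _).
  rewrite !prod1' !mulr1 /Kdisc_term prod1' mulr1.
  rewrite (_ : (fun y => \sum_(x | le y x) _) = h); last first.
    by apply: funext => y; apply: eq_bigr => z _; rewrite prod1' mulr1.
  by rewrite prod1 mulr1.
rewrite sum_mul_mass -/h.
apply: le_trans (doob_maximal le_refl le_asym le_tr le_forest s1 _ _) => //.
apply: ler_sum => y _.
have := w_ge0 ord_max y; rewrite le_eqVlt => /predU1P[<-|wy].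
  by rewrite !mulr0.
rewrite mulrA ler_wpM2r// -(mulr_powRB1 (maxf_ge0 _ _ _ _) s0)//.
rewrite ler_wpM2r ?powR_ge0//.
apply: (@le_trans _ _ (avg (w ord_max) h y)); last exact: avg_le_maxf.
apply: le_avg_decreasing => // x xy; apply: ler_sum_sub => // [z yz|z _].
  exact: le_tr yz.
exact: Kdisc_ge0.
Qed.

Definition ordered (g : 'I_n.+1 -> I -> R) : {set I} :=
  [set x | [forall i : 'I_n.+1, forall j : 'I_n.+1, (i <= j)%N ==>
    le (stop le (w i) (g i) x) (stop le (w j) (g j) x)]].

Definition sufficiency_const : R := 4 ^+ n.+1 *
  (\prod_i carleson_const (p i) `^ (p i)^-1 *
   doob_const (sexpo n) `^ theta n.+1).

(** The average of [g i] over [x] is at most twice the level of its principal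
    cube.  If the principal cubes are sorted then the [i']-th one above [x] is
    also the [i']-th one above the [i]-th one, for i <= i': the level is
    monotone between the two.  Hence [nested_bound] applies. *)
Lemma ordered_embedding (g : 'I_n.+1 -> I -> R) : (forall i y, 0 <= g i y) ->
  \sum_(x in ordered g) k x * \prod_i mass (fun y => g i y * w i y) x <=
  sufficiency_const * testing_sum `^ theta n.+1 *
    \prod_i (\sum_y g i y `^ p i * w i y) `^ (p i)^-1.
Proof.
move=> g0; pose tau i := stop le (w i) (g i); pose beta i := level le (w i) (g i).
have b_anti i := @level_anti _ _ _ le_refl le_tr (w i) (g i).
have m0 i x : 0 <= mass (w i) x by exact: mass_ge0.
have le_tau i x : le x (tau i x) by exact: le_top.
have beta0 i x : 0 <= beta i x by exact: dyadic_floor_ge0.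
have stop_above (i i' : 'I_n.+1) x : x \in ordered g -> (i <= i')%N ->
    tau i' (tau i x) = tau i' x.
  rewrite inE => /forallP/(_ i)/forallP/(_ i')/implyP h /h{}h.
  have E : beta i' (tau i x) = beta i' x.
    apply/eqP; rewrite eq_le (b_anti i' _ _ (le_tau i x)) /=.
    have -> : beta i' x = beta i' (tau i' x).
      by rewrite /beta /tau /stop b_top.
    exact: b_anti.
  exact: (top_eq le_refl le_asym le_tr le_forest (le_tau i x) E).
have nested (i i' : 'I_n.+1) x y : x \in ordered g -> y \in ordered g -> (i <= i')%N ->
    tau i x = tau i y -> tau i' x = tau i' y.
  move=> xg yg ii' xy.
  apply: etrans (esym (stop_above i i' x xg ii')) _.
  exact: etrans (congr1 (tau i') xy) (stop_above i i' y yg ii').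
have nb := @nested_bound_all tau beta (ordered g) le_tau nested beta0 n.+1 (leqnn _)
  (ordered g) (fintype.subxx _).
have ltT (F : 'I_n.+1 -> R) : \prod_(i < n.+1 | (i < n.+1)%N) F i = \prod_i F i.
  by apply: eq_bigl => i; rewrite ltn_ord.
set A := \sum_(x in ordered g) Kdisc_term 0 x * \prod_i beta i (tau i x).
set Q := \prod_i carleson_sum tau beta i (ordered g) `^ (p i)^-1.
set T := (\sum_(x in ordered g) Kdisc_term n.+1 x) `^ theta n.+1.
have AQT : A <= 2 ^+ n.+1 * (Q * T).
  rewrite /Q -ltT; apply: le_trans nb.
  by apply: ler_sum => x _; rewrite ltT.
set Y := \prod_(_ < _) _.
have Y0 : 0 <= Y by apply: prodr_ge0 => i _; exact: powR_ge0.
have CC0 i : 0 <= carleson_const (p i).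
  by rewrite !mulr_ge0 ?powR_ge0 ?geometric_const_ge0 ?subr_gt0.
have QY : Q <= \prod_i carleson_const (p i) `^ (p i)^-1 * Y.
  rewrite -big_split/=; apply: ler_prod => i _; rewrite powR_ge0/=.
  have pi0 : 0 < p i by exact: lt_trans (p_gt1 i).
  rewrite -powRM//; last first.
    by apply: sumr_ge0 => y _; rewrite mulr_ge0 ?powR_ge0.
  apply: powR_le2r; first by rewrite invr_ge0 ltW.
    by apply: sumr_ge0 => y _; rewrite mulr_ge0 ?powR_ge0.
  apply: le_trans (carleson_embedding le_refl le_asym le_tr le_forest (p_gt1 i) (w_ge0 i) (g0 i)).
  apply: ler_sum_sub => // [F /imsetP[x _ ->]|F _].
    by rewrite /tau /stop top_idem.
  by rewrite mulr_ge0 ?powR_ge0.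
have dn0 : 0 <= doob_const (sexpo n).
  have s1 : 1 < sexpo n := sexpo_gt1 p_gt1 p_sum ord_max.
  by rewrite !mulr_ge0 ?powR_ge0 ?geometric_const_ge0 ?subr_gt0.
have ts0 : 0 <= testing_sum.
  by apply: sumr_ge0 => y _; rewrite mulr_ge0 ?powR_ge0.
have TT : T <= doob_const (sexpo n) `^ theta n.+1 * testing_sum `^ theta n.+1.
  rewrite -powRM//; apply: powR_le2r.
  - exact/ltW/theta_gt0.
  - by apply: sumr_ge0 => x _; exact: Kdisc_term_ge0.
  - apply: le_trans sum_Kdisc_le_testing; apply: ler_sum_sub => // x _.
    exact: Kdisc_term_ge0.
(* one factor 2 for each average that is replaced by a level *)
apply: (@le_trans _ _ (2 ^+ n.+1 * A)).
  rewrite /A mulr_sumr; apply: ler_sum => x _.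
  rewrite /Kdisc_term/= -mulrA mulrCA ler_wpM2l//.
  have -> : 2 ^+ n.+1 = \prod_(i < n.+1) 2 :> R by rewrite prodr_const card_ord.
  have -> : \prod_(i < n.+1 | (0 <= i)%N) mass (w i) x = \prod_i mass (w i) x by [].
  rewrite -!big_split/=; apply: ler_prod => i _.
  rewrite mass_ge0/= => [|y]; last by rewrite mulr_ge0.
  rewrite -mul_mass_avg// mulrCA ler_wpM2l//.
  apply: (@le_trans _ _ (maxf (w i) (g i) x)); first exact: avg_le_maxf.
  rewrite /beta /tau /stop b_top//.
  by apply: le_dyadic_floor; exact: maxf_ge0.
rewrite /sufficiency_const.
have -> : 4 ^+ n.+1 = 2 ^+ n.+1 * 2 ^+ n.+1 :> R.
  by rewrite -exprMn; congr (_ ^+ _); ring.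
set c1 := \prod_i carleson_const _ `^ _ in QY *; set d1 := doob_const _ `^ _ in TT *.
rewrite [leRHS](_ : _ = 2 ^+ n.+1 * (2 ^+ n.+1 *
  ((c1 * Y) * (d1 * testing_sum `^ theta n.+1)))); last by ring.
rewrite ler_wpM2l ?exprn_ge0//; apply: (le_trans AQT).
rewrite ler_wpM2l ?exprn_ge0//; apply: ler_pM => //; last exact: powR_ge0.
by apply: prodr_ge0 => i _; exact: powR_ge0.
Qed.

End Kernel.

Lemma sufficiency_const_ge0 (R : realType) n (p : 'I_n.+1 -> R) :
  0 <= sufficiency_const p.
Proof.
rewrite !mulr_ge0 ?exprn_ge0 ?powR_ge0//.
by apply: prodr_ge0 => i _; exact: powR_ge0.
Qed.

Lemma sorting_perm n (L : rel 'I_n.+1) : total L -> reflexive L -> transitive L ->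
  exists phi : 'S_n.+1, forall i j : 'I_n.+1, (i <= j)%N -> L (phi i) (phi j).
Proof.
move=> Lt Lr Ltr; pose s := sort L (enum 'I_n.+1).
have ss : size s = n.+1 by rewrite size_sort size_enum_ord.
have us : uniq s by rewrite sort_uniq enum_uniq.
have inj : injective (fun i : 'I_n.+1 => nth ord0 s i).
  move=> i j /eqP; rewrite nth_uniq ?ss// => /eqP; exact: val_inj.
exists (perm inj) => i j ij; rewrite !permE.
by apply: (sorted_leq_nth Ltr Lr) => //; rewrite ?inE ?ss// sort_sorted.
Qed.

Section Discrete.
Variables (R : realType) (I : finType) (le : rel I) (n : nat).
Variables (p : 'I_n.+1 -> R) (w : 'I_n.+1 -> I -> R) (k : I -> R).
Hypotheses (le_refl : reflexive le) (le_asym : antisymmetric le).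
Hypothesis le_tr : transitive le.
Hypothesis le_forest : forall x y z, le x y -> le x z -> le y z || le z y.
Hypothesis p_gt1 : forall i, 1 < p i.
Hypothesis p_sum : \sum_i (p i)^-1 < 1.
Hypotheses (w_ge0 : forall i x, 0 <= w i x) (k_ge0 : forall x, 0 <= k x).

(** For each cube the principal cubes in the different variables are comparable
    and can be sorted, so the sets [ordered] of all permutations cover the
    forest. *)
Lemma testing_embedding_discrete c : 0 <= c ->
  (forall phi : 'S_n.+1, testing_sum le (p \o phi) (w \o phi) k
     <= c `^ rexpo (p \o phi) n.+1) ->
  embedding_discrete le p w k
    ((\sum_(phi : 'S_n.+1) sufficiency_const (p \o phi)) * c).
Proof.
move=> c0 test g g0; set Y := \prod_i _.
have pphi (phi : 'S_n.+1) : \sum_i ((p \o phi) i)^-1 < 1.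
  by move: p_sum; rewrite (reindex_inj (@perm_inj _ phi)).
have p1 (phi : 'S_n.+1) i : 1 < (p \o phi) i by exact: p_gt1.
have w1 (phi : 'S_n.+1) i x : 0 <= (w \o phi) i x by exact: w_ge0.
pose t x := k x * \prod_i mass le (fun y => g i y * w i y) x.
have t0 x : 0 <= t x.
  rewrite mulr_ge0//; apply: prodr_ge0 => i _; apply: mass_ge0 => y.
  by rewrite mulr_ge0.
pose X (phi : 'S_n.+1) := ordered le (w \o phi) (g \o phi).
have cover x : exists phi, x \in X phi.
  pose L := relpre (fun i => stop le (w i) (g i) x) le.
  have Ltot : total L by move=> i j; apply: (le_forest (x := x)); exact: le_top.
  have Lrefl : reflexive L by move=> i; exact: le_refl.
  have Ltrans : transitive L by move=> i j l; exact: le_tr.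
  have [phi Lphi] := sorting_perm Ltot Lrefl Ltrans.
  exists phi; rewrite inE; apply/forallP => i; apply/forallP => j.
  by apply/implyP; exact: Lphi.
apply: (@le_trans _ _ (\sum_(phi : 'S_n.+1) \sum_(x in X phi) t x)).
  rewrite (exchange_big_dep xpredT)//=; apply: ler_sum => x _.
  have [phi xphi] := cover x.
  by rewrite (bigD1 phi)//= lerDl sumr_ge0.
rewrite -mulrA mulr_suml; apply: ler_sum => phi _.
have th := theta_gt0 (p1 phi) (pphi phi) n.+1.
have := ordered_embedding le_refl le_asym le_tr le_forest (p1 phi) (pphi phi)
  (w1 phi) k_ge0 (fun i => g0 (phi i)).
have -> : \prod_i (\sum_y (g \o phi) i y `^ (p \o phi) i * (w \o phi) i y)
    `^ ((p \o phi) i)^-1 = Y.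
  by rewrite /Y [RHS](reindex_inj (@perm_inj _ phi)).
move=> H.
have -> : \sum_(x in X phi) t x = \sum_(x in X phi) k x *
    \prod_i mass le (fun y => (g \o phi) i y * (w \o phi) i y) x.
  apply: eq_bigr => x _; congr (_ * _).
  exact: (reindex_inj (@perm_inj _ phi)).
apply: (le_trans H); rewrite -mulrA.
rewrite ler_wpM2l ?sufficiency_const_ge0// ler_wpM2r//.
  by apply: prodr_ge0 => i _; exact: powR_ge0.
have ts0 : 0 <= testing_sum le (p \o phi) (w \o phi) k.
  by apply: sumr_ge0 => y _; rewrite mulr_ge0 ?powR_ge0.
have := powR_le2r (ltW th) ts0 (test phi).
by rewrite -powRrM /rexpo mulVf ?gt_eqF// powRr1.
Qed.

End Discrete.

Local Open Scope classical_set_scope.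
Local Open Scope ring_scope.

(** * The atoms of a finite nested family *)

Section Atoms.
Context (d : measure_display) (T : measurableType d) (R : realType) (I : finType).
Variable Q : I -> set T.
Hypothesis mQ : forall x, measurable (Q x).
Hypothesis Q_inj : injective Q.
Hypothesis Q_neq0 : forall x, Q x !=set0.
Hypothesis Q_nested : forall x y t, Q x t -> Q y t ->
  Q x `<=` Q y \/ Q y `<=` Q x.

Definition cle : rel I := fun x y => `[< Q x `<=` Q y >].

Lemma cle_refl : reflexive cle.
Proof. by move=> x; apply/asboolP. Qed.

Lemma cle_anti : antisymmetric cle.
Proof.
by move=> x y /andP[/asboolP xy /asboolP yx]; apply/Q_inj/seteqP; split.
Qed.

Lemma cle_trans : transitive cle.
Proof.
move=> y x z /asboolP xy /asboolP yz; apply/asboolP.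
exact: classical_sets.subset_trans yz.
Qed.

Lemma cle_forest x y z : cle x y -> cle x z -> cle y z || cle z y.
Proof.
move=> /asboolP xy /asboolP xz; have [t xt] := Q_neq0 x.
have [h|h] := Q_nested (xy _ xt) (xz _ xt).
  by apply/orP; left; apply/asboolP.
by apply/orP; right; apply/asboolP.
Qed.

Definition atom x := Q x `\` \bigcup_(y in [set y | cle y x && (y != x)]) Q y.

Lemma measurable_atom x : measurable (atom x).
Proof.
by apply: measurableD => //; apply: fin_bigcup_measurable => //; exact: finite_finset.
Qed.

Lemma atom_cube x t : atom x t -> Q x t. Proof. by case. Qed.

(** The cube of the atom of [t] is the smallest one that contains [t]. *)
Lemma atom_cle x y t : atom y t -> Q x t -> cle y x.
Proof.
move=> [yt ny] xt; have [h|h] := Q_nested yt xt; first exact/asboolP.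
have [->|xy] := eqVneq x y; first exact: cle_refl.
by exfalso; apply: ny; exists x => //=; rewrite xy andbT; apply/asboolP.
Qed.

Lemma atom_inj x y t : atom x t -> atom y t -> x = y.
Proof.
move=> xt yt; apply: cle_anti; apply/andP; split.
  exact: atom_cle xt (atom_cube yt).
exact: atom_cle yt (atom_cube xt).
Qed.

(** Among the cubes that contain [t], take one with the fewest cubes below it. *)
Lemma cube_atom x t : Q x t -> exists2 y, cle y x & atom y t.
Proof.
move=> xt; pose y := [arg min_(y < x | `[< Q y t >]) #|[set z | cle z y]%SET|].
have [yt ymin] : Q y t /\ forall z, Q z t ->
    (#|[set u | cle u y]%SET| <= #|[set u | cle u z]%SET|)%N.
  rewrite /y; case: arg_minnP => [|z /asboolP zt zmin]; first exact/asboolP.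
  by split=> // u ut; apply: zmin; exact/asboolP.
suff yat : atom y t by exists y => //; exact: atom_cle yat xt.
split=> // -[z /= /andP[zy zny] zt].
have : ([set u | cle u z] \proper [set u | cle u y])%SET.
  apply/properP; split.
    by apply/fintype.subsetP => u; rewrite !finset.in_set => uz; exact: cle_trans zy.
  exists y; rewrite !finset.in_set ?cle_refl//; apply: contra zny => yz.
  by apply/eqP/cle_anti; rewrite zy.
by move=> /proper_card; rewrite ltnNge ymin.
Qed.

Lemma cube_big_atom x :
  Q x = \big[setU/set0]_(y <- [seq y <- enum I | cle y x]) atom y.
Proof.
rewrite -bigcup_seq; apply/seteqP; split => [t /cube_atom[y yx yt]|t [y /=]].
  by exists y => //=; rewrite mem_filter yx mem_enum.
by rewrite mem_filter => /andP[/asboolP yx _] /atom_cube /yx.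
Qed.

Lemma trivIset_atom D : trivIset D atom.
Proof. by move=> x y _ _ [t [xt yt]]; exact: atom_inj xt yt. Qed.

Definition stepf (c : I -> R) (t : T) : R := \sum_y c y * \1_(atom y) t.

Lemma stepf_atom c y t : atom y t -> stepf c t = c y.
Proof.
move=> yt; rewrite /stepf (bigD1 y)//= indicE mem_set// mulr1 big1 ?addr0// => z zy.
rewrite indicE memNset ?mulr0// => zt; move/eqP: zy; apply; exact: atom_inj zt yt.
Qed.

Lemma stepf_out c t : (forall y, ~ atom y t) -> stepf c t = 0.
Proof. by move=> nt; rewrite /stepf big1// => y _; rewrite indicE memNset ?mulr0. Qed.

Lemma stepf_comp (f : R -> R) c t : f 0 = 0 -> f (stepf c t) = stepf (f \o c) t.
Proof.
move=> f0; have [[y yt]|nt] := pselect (exists y, atom y t).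
  by rewrite !(stepf_atom _ yt).
have nt' y : ~ atom y t by move=> yt; apply: nt; exists y.
by rewrite !stepf_out.
Qed.

Lemma measurable_stepf c : measurable_fun setT (stepf c).
Proof.
apply: measurable_sum => y; apply: measurable_funM => //.
by apply: measurable_indic; exact: measurable_atom.
Qed.

Variable mu : {measure set T -> \bar R}.
Hypothesis mu_fin : forall x, (mu (Q x) < +oo)%E.

Definition weight x : R := fine (mu (atom x)).

Lemma weight_ge0 x : 0 <= weight x.
Proof. exact: fine_ge0. Qed.

Lemma weightE x : (weight x)%:E = mu (atom x).
Proof.
rewrite fineK// ge0_fin_numE//; apply: le_lt_trans (mu_fin x).
by apply: le_measure; rewrite ?inE//; [apply: measurable_atom|move=> t []].
Qed.

Lemma ge0_integral_cube x (f : T -> \bar R) : measurable_fun setT f ->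
  (forall t, 0 <= f t)%E ->
  (\int[mu]_(t in Q x) f t = \sum_(y | cle y x) \int[mu]_(t in atom y) f t)%E.
Proof.
move=> mf f0; rewrite [in LHS]cube_big_atom ge0_integral_bigsetU//.
- by rewrite big_filter big_enum_cond/=.
- exact: measurable_atom.
- by rewrite filter_uniq// enum_uniq.
- exact: trivIset_atom.
- exact: measurable_funTS.
Qed.

Lemma mu_cube x : mu (Q x) = (mass cle weight x)%:E.
Proof.
rewrite -[LHS]mul1e -integral_cst// ge0_integral_cube//.
rewrite /mass -sumEFin; apply: eq_bigr => y _.
by rewrite integral_cst ?mul1e ?weightE//; exact: measurable_atom.
Qed.

Lemma integral_cube x (f : T -> R) : measurable_fun setT f ->
  (\int[mu]_(t in Q x) (f t)%:E = \sum_(y | cle y x) \int[mu]_(t in atom y) (f t)%:E)%E.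
Proof.
move=> mf; rewrite [in LHS]cube_big_atom integral_bigsetU_EFin//.
- by rewrite big_filter big_enum_cond/=.
- exact: measurable_atom.
- by rewrite filter_uniq// enum_uniq.
- exact: trivIset_atom.
- by apply: measurable_funTS; exact/measurable_EFinP.
Qed.

Lemma integral_stepf c : (forall y, 0 <= c y) ->
  (\int[mu]_t (stepf c t)%:E = (\sum_y c y * weight y)%:E)%E.
Proof.
move=> c0; rewrite /stepf; under eq_integral do rewrite -sumEFin.
rewrite ge0_integral_sum//=.
- rewrite -sumEFin; apply: eq_bigr => y _.
  under eq_integral do rewrite EFinM.
  rewrite ge0_integralZl_EFin//=.
  + by rewrite integral_indic ?setIT ?EFinM ?weightE//; exact: measurable_atom.
  + by apply/measurable_EFinP; apply: measurable_indic; exact: measurable_atom.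
- move=> y; apply/measurable_EFinP; apply: measurable_funM => //.
  by apply: measurable_indic; exact: measurable_atom.
- by move=> y t _; rewrite lee_fin mulr_ge0.
Qed.

Lemma integral_atom_stepf c y :
  (\int[mu]_(t in atom y) (stepf c t)%:E = (c y * weight y)%:E)%E.
Proof.
rewrite (eq_integral (fun=> (c y)%:E)) => [|t]; last first.
  by rewrite inE => yt; rewrite (stepf_atom _ yt).
by rewrite integral_cst ?EFinM ?weightE//; exact: measurable_atom.
Qed.

Lemma integral_cube_stepf c x :
  (\int[mu]_(t in Q x) (stepf c t)%:E = (mass cle (fun y => c y * weight y) x)%:E)%E.
Proof.
rewrite integral_cube; last exact: measurable_stepf.
by rewrite /mass -sumEFin; apply: eq_bigr => y _; rewrite integral_atom_stepf.
Qed.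

Lemma Lnorm_stepf c p : 0 < p -> (forall y, 0 <= c y) ->
  ('N[mu]_p%:E [EFin \o stepf c])%E = ((\sum_y c y `^ p * weight y) `^ p^-1)%:E.
Proof.
move=> p0 c0; rewrite unlock/=.
rewrite (eq_integral (fun t => (stepf (fun y => c y `^ p) t)%:E)) => [|t _].
  by rewrite integral_stepf// => y; exact: powR_ge0.
rewrite (_ : (fun y => c y `^ p) = (fun u => `|u| `^ p) \o c); last first.
  by apply/funext => y /=; rewrite ger0_norm.
by rewrite -(@stepf_comp (fun u => `|u| `^ p))//= normr0 powR0// gt_eqF.
Qed.

Lemma stepf_Lfun c p : 0 < p -> (forall y, 0 <= c y) -> stepf c \in Lfun mu p%:E.
Proof.
move=> p0 c0; rewrite inE; apply/andP; split; rewrite inE/=.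
  exact: measurable_stepf.
by rewrite /finite_norm Lnorm_stepf// ltry.
Qed.

(** Hoelder's inequality against the indicator function of [E]. *)
Lemma integral_abs_le_powR (f : T -> R) p E : 1 < p -> measurable_fun setT f ->
  measurable E -> (mu E < +oo)%E ->
  (\int[mu]_(t in E) `|(f t)%:E| <=
   (\int[mu]_(t in E) (`|f t| `^ p)%:E) `^ p^-1 * (mu E) `^ (1 - p^-1))%E.
Proof.
move=> p1 mf mE muE; have p0 : 0 < p by exact: lt_trans p1.
have q0 : 0 < (1 - p^-1)^-1 by rewrite invr_gt0 subr_gt0 invf_lt1.
have m1 : measurable_fun setT (\1_E : T -> R) by exact: measurable_indic.
have := @hoelder _ T R mu (f \* \1_E) \1_E p _ (measurable_funM mf m1) m1 p0 q0.
rewrite invrK subrKC => /(_ erefl).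
rewrite Lnorm1 unlock/= invrK.
have indE (t : T) : (\1_E t : R) = if t \in E then 1 else 0.
  by rewrite indicE; case: (t \in E).
have -> : (\int[mu]_t `|(f t * \1_E t * \1_E t)%:E| =
    \int[mu]_(t in E) `|(f t)%:E|)%E.
  rewrite [RHS]integral_mkcond; apply: eq_integral => t _.
  by rewrite /patch indE; case: ifPn => _; rewrite ?mulr1 ?mulr0 ?abse0.
have -> : (\int[mu]_t (`|f t * \1_E t| `^ p)%:E =
    \int[mu]_(t in E) (`|f t| `^ p)%:E)%E.
  rewrite [RHS]integral_mkcond; apply: eq_integral => t _.
  rewrite /patch indE; case: ifPn => _; rewrite ?mulr1 ?mulr0// normr0.
  by rewrite powR0// gt_eqF.
have -> // : (\int[mu]_t (`|\1_E t| `^ (1 - p^-1)^-1)%:E = mu E)%E.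
rewrite -[RHS]mul1e -integral_cst// [RHS]integral_mkcond; apply: eq_integral => t _.
rewrite /patch indE; case: ifPn => _; first by rewrite normr1 powR1.
by rewrite normr0 powR0// gt_eqF.
Qed.

(** This is 0 on an atom of measure zero, where the integral of a function in L^p
    also vanishes. *)
Definition atom_avg (f : T -> R) (y : I) : R :=
  fine (\int[mu]_(t in atom y) `|(f t)%:E|)%E / weight y.

Lemma atom_avg_ge0 f y : 0 <= atom_avg f y.
Proof.
by rewrite divr_ge0 ?weight_ge0// fine_ge0// integral_ge0// => t _; exact: abse_ge0.
Qed.

Section Average.
Variables (f : T -> R) (p : R).
Hypotheses (p_gt1 : 1 < p) (f_Lp : f \in Lfun mu p%:E).

Let mf : measurable_fun setT f.
Proof. by move: f_Lp; rewrite inE => /andP[]; rewrite inE. Qed.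

Let p_gt0 : 0 < p. Proof. exact: lt_trans p_gt1. Qed.

Let mfp : measurable_fun setT (fun t => (`|f t| `^ p)%:E).
Proof.
apply/measurable_EFinP; apply: (measurableT_comp (measurable_powR p)).
exact: measurableT_comp.
Qed.

Let fpE : ('N[mu]_p%:E [EFin \o f])%E = ((\int[mu]_t (`|f t| `^ p)%:E) `^ p^-1)%E.
Proof. by rewrite unlock. Qed.

Lemma integral_powR_lty : (\int[mu]_t (`|f t| `^ p)%:E < +oo)%E.
Proof.
move: f_Lp; rewrite inE => /andP[_]; rewrite inE/= /finite_norm fpE.
by apply: lty_poweRy; rewrite invr_eq0 gt_eqF.
Qed.

Let intp_lty E : measurable E -> (\int[mu]_(t in E) (`|f t| `^ p)%:E < +oo)%E.
Proof.
move=> mE; apply: le_lt_trans integral_powR_lty.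
by apply: ge0_subset_integral => // t _; rewrite lee_fin powR_ge0.
Qed.

Let mu_atom_lty y : (mu (atom y) < +oo)%E. Proof. by rewrite -weightE ltry. Qed.

Let int_fin y : (\int[mu]_(t in atom y) `|(f t)%:E|)%E \is a fin_num.
Proof.
rewrite ge0_fin_numE ?integral_ge0//.
apply: le_lt_trans (integral_abs_le_powR p_gt1 mf (measurable_atom y) (mu_atom_lty y)) _.
by rewrite lte_mul_pinfty ?poweR_ge0// ?fin_num_poweR ?poweR_lty//
  ge0_fin_numE ?intp_lty//; [exact: measurable_atom|
  apply: integral_ge0 => t _; rewrite lee_fin powR_ge0].
Qed.

Let b y : R := fine (\int[mu]_(t in atom y) (`|f t| `^ p)%:E)%E.

Let bE y : (b y)%:E = (\int[mu]_(t in atom y) (`|f t| `^ p)%:E)%E.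
Proof.
rewrite fineK// ge0_fin_numE ?intp_lty//; first exact: measurable_atom.
by apply: integral_ge0 => t _; rewrite lee_fin powR_ge0.
Qed.

Let b_ge0 y : 0 <= b y.
Proof. by apply/fine_ge0/integral_ge0 => t _; rewrite lee_fin powR_ge0. Qed.

Let jensen y : fine (\int[mu]_(t in atom y) `|(f t)%:E|)%E <=
  b y `^ p^-1 * weight y `^ (1 - p^-1).
Proof.
rewrite -lee_fin fineK// EFinM -!poweR_EFin bE weightE.
exact: (integral_abs_le_powR p_gt1 mf (measurable_atom y) (mu_atom_lty y)).
Qed.

Let atom_avgM y : (atom_avg f y * weight y)%:E = (\int[mu]_(t in atom y) `|(f t)%:E|)%E.
Proof.
rewrite /atom_avg; have [w0|w0] := eqVneq (weight y) 0; last by rewrite divfK// fineK.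
rewrite w0 mulr0; apply/esym/eqP; rewrite eq_le integral_ge0// andbT.
rewrite -(fineK (int_fin y)) lee_fin; apply: le_trans (jensen y) _.
by rewrite w0 powR0 ?mulr0// subr_eq0 eq_sym lt_eqF// invf_lt1.
Qed.

Lemma abse_integral_cube_le x : (`|\int[mu]_(t in Q x) (f t)%:E| <=
  (mass cle (fun y => atom_avg f y * weight y) x)%:E)%E.
Proof.
apply: (@le_trans _ _ (\int[mu]_(t in Q x) `|(f t)%:E|)%E).
  by apply: le_abse_integral => //; exact/measurable_EFinP/measurable_funTS.
rewrite ge0_integral_cube//; last exact/measurableT_comp/measurable_EFinP.
by rewrite /mass -sumEFin; apply: lee_sum => y _; rewrite atom_avgM.
Qed.

Lemma atom_avg_Lnorm_le :
  (((\sum_y atom_avg f y `^ p * weight y) `^ p^-1)%:E <= 'N[mu]_p%:E [EFin \o f])%E.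
Proof.
rewrite fpE -poweR_EFin; apply: gt0_ler_poweR.
- by rewrite invr_ge0 ltW.
- rewrite in_itv/= leey andbT lee_fin.
  by apply: sumr_ge0 => y _; rewrite mulr_ge0 ?powR_ge0 ?weight_ge0.
- rewrite in_itv/= leey andbT.
  by apply: integral_ge0 => t _; rewrite lee_fin powR_ge0.
apply: (@le_trans _ _ (\sum_y (b y)%:E)%E).
  rewrite -sumEFin; apply: lee_sum => y _; rewrite lee_fin.
  have [w0|w0] := eqVneq (weight y) 0; first by rewrite w0 mulr0.
  have {}w0 : 0 < weight y by rewrite lt_neqAle eq_sym w0 weight_ge0.
  have := powR_le2r (ltW p_gt0) _ (jensen y).
  rewrite powRM ?powR_ge0// -!powRrM mulVf ?gt_eqF// powRr1// => h.
  rewrite /atom_avg powRM ?invr_ge0 ?weight_ge0//; last first.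
    by rewrite fine_ge0// integral_ge0.
  rewrite -[X in _ * X `^ p]powR_inv1 ?weight_ge0// -powRrM mulN1r.
  rewrite -mulrA -[X in _ * (_ * X)]powRr1 ?weight_ge0// -powRD; last first.
    by rewrite (gt_eqF w0) implybT.
  rewrite -ler_pdivlMr ?powR_gt0// -powRN; apply: (le_trans (h _)).
    by rewrite fine_ge0// integral_ge0.
  rewrite le_eqVlt; apply/orP; left; apply/eqP; congr (_ * _ `^ _).
  by rewrite mulrBl mul1r mulVf ?gt_eqF//; ring.
rewrite (eq_bigr _ (fun y _ => bE y)).
have -> : (\sum_y \int[mu]_(t in atom y) (`|f t| `^ p)%:E =
    \int[mu]_(t in \big[setU/set0]_(y <- enum I) atom y) (`|f t| `^ p)%:E)%E.
  rewrite ge0_integral_bigsetU//.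
  - by rewrite big_enum.
  - exact: measurable_atom.
  - exact: enum_uniq.
  - exact: trivIset_atom.
  - exact: measurable_funTS.
apply: ge0_subset_integral => //.
by apply: bigsetU_measurable => y _; exact: measurable_atom.
Qed.

End Average.

End Atoms.

(** * Increasing limits in the extended reals *)

Section IncreasingTo.
Context {R : realType}.
Implicit Types (u v : nat -> \bar R) (l : \bar R).
Local Open Scope ereal_scope.

(** Increasing convergence is stated by upper bounds: this form passes through
    sums, products and powers of nonnegative sequences, including the products
    of 0 and infinity. *)
Definition incr_to u l := [/\ {homo u : m k / (m <= k)%N >-> m <= k},
  forall m, u m <= l & forall B, (forall m, u m <= B) -> l <= B].

Lemma incr_to_cst l : incr_to (fun=> l) l.
Proof. by split=> // B /(_ 0%N). Qed.

Lemma incr_to_ge0 u l : (forall m, 0 <= u m) -> incr_to u l -> 0 <= l.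
Proof. by move=> u0 [_ /(_ 0%N) ul _]; exact: le_trans (u0 0%N) ul. Qed.

Lemma incr_to_add u v l l' : (forall m, 0 <= u m) -> (forall m, 0 <= v m) ->
  incr_to u l -> incr_to v l' -> incr_to (fun m => u m + v m) (l + l').
Proof.
move=> u0 v0 ul vl; have l0 := incr_to_ge0 u0 ul; have l'0 := incr_to_ge0 v0 vl.
case: ul => ui ul lu; case: vl => vi vl lv; split.
- by move=> m k mk; rewrite leeD ?ui ?vi.
- by move=> m; rewrite leeD.
case=> [b|_|/(_ 0%N)]; last 2 first.
- exact: leey.
- by rewrite leeNy_eq => /eqP uv; have := adde_ge0 (u0 0%N) (v0 0%N); rewrite uv.
move=> uvb; have uv m k : u m + v k <= b%:E.
  by apply: le_trans (uvb (maxn m k)); rewrite leeD ?ui ?vi ?leq_maxl ?leq_maxr.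
have ufin m : u m \is a fin_num.
  rewrite ge0_fin_numE//; apply: le_lt_trans (ltry b).
  by apply: le_trans (uv m 0%N); rewrite leeDl.
have ul'b m : u m + l' <= b%:E.
  by rewrite addeC -leeBrDr//; apply: lv => k; rewrite leeBrDr// addeC.
have l'fin : l' \is a fin_num.
  rewrite ge0_fin_numE//; apply: le_lt_trans (ltry b).
  by apply: le_trans (ul'b 0%N); rewrite leeDr.
by rewrite -leeBrDr//; apply: lu => k; rewrite leeBrDr.
Qed.

(** For infinite [a] either [l] is 0, or some [v k] is positive and then [B] is
    infinite. *)
Lemma incr_to_mule_le a v l B : 0 <= a -> (forall m, 0 <= v m) -> incr_to v l ->
  (forall k, a * v k <= B) -> a * l <= B.
Proof.
move=> a0 v0 vl avB; have l0 := incr_to_ge0 v0 vl; have [vi vl' lv] := vl.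
case: a a0 avB => [r|_|//].
  rewrite lee_fin => r0 avB; have [rE|r_neq0] := eqVneq r 0%R.
    by move: (avB 0%N); rewrite rE !mul0e.
  have {r_neq0}r0 : (0 < r)%R by rewrite lt_neqAle eq_sym r_neq0.
  by rewrite -lee_pdivlMl//; apply: lv => k; rewrite lee_pdivlMl.
move=> avB; have [lE|l_neq0] := eqVneq l 0.
  by rewrite lE mule0; apply: le_trans (avB 0%N); rewrite mule_ge0.
have [k vk] : exists k, 0 < v k.
  apply/not_existsP => vn; move/eqP: l_neq0; apply.
  apply/eqP; rewrite eq_le l0 andbT; apply: lv => k.
  by rewrite leNgt; apply/negP/vn.
by move: (avB k); rewrite gt0_mulye// => yB; apply: le_trans yB; exact: leey.
Qed.

Lemma incr_to_mul u v l l' : (forall m, 0 <= u m) -> (forall m, 0 <= v m) ->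
  incr_to u l -> incr_to v l' -> incr_to (fun m => u m * v m) (l * l').
Proof.
move=> u0 v0 ul vl; have l0 := incr_to_ge0 u0 ul; have l'0 := incr_to_ge0 v0 vl.
have [ui ul' lu] := ul; have [vi vl' lv] := vl; split.
- by move=> m k mk; rewrite lee_pmul ?ui ?vi.
- by move=> m; rewrite lee_pmul.
move=> B uvB; rewrite muleC; apply: (incr_to_mule_le l'0 u0 ul) => m.
rewrite muleC; apply: (incr_to_mule_le (u0 m) v0 vl) => k.
by apply: le_trans (uvB (maxn m k)); rewrite lee_pmul ?ui ?vi ?leq_maxl ?leq_maxr.
Qed.

Lemma lee_poweR (x y : \bar R) r : (0 <= r)%R -> 0 <= x -> x <= y -> x `^ r <= y `^ r.
Proof.
move=> r0 x0 xy; apply: gt0_ler_poweR => //; rewrite in_itv/= leey andbT//.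
exact: le_trans xy.
Qed.

Lemma poweRK (x : \bar R) r : (r != 0)%R -> 0 <= x -> (x `^ r) `^ r^-1 = x.
Proof. by move=> r0 x0; rewrite -poweRrM mulfV// poweRe1. Qed.

Lemma incr_to_poweR u l r : (0 < r)%R -> (forall m, 0 <= u m) ->
  incr_to u l -> incr_to (fun m => u m `^ r) (l `^ r).
Proof.
move=> r0 u0 ul; have l0 := incr_to_ge0 u0 ul; have [ui ul' lu] := ul; split.
- by move=> m k mk; apply: lee_poweR; rewrite ?ui// ltW.
- by move=> m; apply: lee_poweR; rewrite // ltW.
move=> B uB; have B0 : 0 <= B by apply: le_trans (uB 0%N); exact: poweR_ge0.
have rn0 : (r != 0)%R by rewrite gt_eqF.
rewrite -[B](@poweRK _ (r^-1)%R) ?invr_eq0// invrK; apply: lee_poweR => //; first exact: ltW.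
apply: lu => m; rewrite -[u m](@poweRK _ r)//; apply: lee_poweR => //.
- by rewrite invr_ge0 ltW.
- exact: poweR_ge0.
Qed.

Lemma incr_to_sum (T : eqType) (s : seq T) (u : T -> nat -> \bar R) (l : T -> \bar R) :
  (forall i m, i \in s -> 0 <= u i m) -> (forall i, i \in s -> incr_to (u i) (l i)) ->
  incr_to (fun m => \sum_(i <- s) u i m) (\sum_(i <- s) l i).
Proof.
elim: s => [_ _|x s IH u0 ul].
  by under eq_fun do rewrite big_nil; rewrite big_nil; exact: incr_to_cst.
under eq_fun do rewrite big_cons; rewrite big_cons.
apply: incr_to_add.
- by move=> m; rewrite u0 ?mem_head.
- by move=> m; rewrite big_seq sume_ge0// => i si; rewrite u0// in_cons si orbT.
- by apply: ul; rewrite mem_head.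
by apply: IH => [i m si|i si]; [apply: u0|apply: ul]; rewrite in_cons si orbT.
Qed.

Lemma incr_to_esum (T : choiceType) (D : set T) (u : T -> nat -> \bar R) (l : T -> \bar R) :
  (forall i m, D i -> 0 <= u i m) -> (forall i, D i -> incr_to (u i) (l i)) ->
  incr_to (fun m => \esum_(i in D) u i m) (\esum_(i in D) l i).
Proof.
move=> u0 ul; split.
- by move=> m k mk; apply: le_esum => i Di; have [ui _ _] := ul i Di; exact: ui.
- by move=> m; apply: le_esum => i Di; have [_ + _] := ul i Di; exact.
move=> B uB; apply: ge_ereal_sup => _ [F [finF FD] <-].
have FD' i : i \in fset_set F -> D i by rewrite in_fset_set// inE => /FD.
have [_ _] : incr_to (fun m => \sum_(i <- fset_set F) u i m) (\sum_(i <- fset_set F) l i).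
  by apply: incr_to_sum => [i m /FD'|i /FD']; [exact: u0|exact: ul].
rewrite fsbig_finite//; apply=> m; apply: le_trans (uB m).
by apply: esum_ge; exists F => //; rewrite fsbig_finite.
Qed.

Lemma incr_to_limn u l : incr_to u l -> limn u = l.
Proof.
move=> [ui ul lu]; have /cvg_lim -> // := ereal_nondecreasing_cvgn ui.
apply/eqP; rewrite eq_le; apply/andP; split.
  by apply: ge_ereal_sup => _ [m _ <-].
by apply: lu => m; apply: ereal_sup_ubound; exists m.
Qed.

Lemma incr_to_integral d (T : measurableType d) (mu : {measure set T -> \bar R})
    (u : nat -> T -> \bar R) (l : T -> \bar R) :
  (forall m, measurable_fun setT (u m)) -> (forall m t, 0 <= u m t) ->
  (forall t, incr_to (u^~ t) (l t)) ->
  incr_to (fun m => \int[mu]_t u m t) (\int[mu]_t l t).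
Proof.
move=> mu' u0 ul.
have ui t : {homo u^~ t : m k / (m <= k)%N >-> m <= k} by have [] := ul t.
have -> : \int[mu]_t l t = limn (fun m => \int[mu]_t u m t).
  rewrite -monotone_convergence//.
  by apply: eq_integral => t _; rewrite (incr_to_limn (ul t)).
have inti : {homo (fun m => \int[mu]_t u m t) : m k / (m <= k)%N >-> m <= k}.
  by move=> m k mk; apply: ge0_le_integral => // t _; exact: ui.
have /cvg_lim -> // := ereal_nondecreasing_cvgn inti.
split=> // [m|B uB]; first by apply: ereal_sup_ubound; exists m.
by apply: ge_ereal_sup => _ [m _ <-].
Qed.

End IncreasingTo.

Lemma lee_prod (R : realType) (I : finType) (F G : I -> \bar R) :
  (forall i, 0 <= F i <= G i)%E -> (\prod_i F i <= \prod_i G i)%E.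
Proof.
move=> FG; suff : (0 <= \prod_i F i <= \prod_i G i)%E by case/andP.
elim/big_rec2 : _ => [|i x y _ /andP[y0 yx]]; first by rewrite lee01 lexx.
by have /andP[F0 FGi] := FG i; rewrite mule_ge0//= lee_pmul.
Qed.

(** * Dyadic cubes *)

Section DyadicCubes.
Context {R : realType} {d : nat}.
Notation Rd := (borelRd R d).
Notation cube := (@dyadic_cube R d).

Lemma measurable_coord_lt (i : 'I_d) (a : R) :
  measurable ([set x : 'rV[R]_d | x ord0 i < a] : set Rd).
Proof.
apply: sub_sigma_algebra => /=.
apply: (@open_comp _ _ (fun x : 'rV[R]_d => x ord0 i) [set y | y < a]).
  by move=> x _; exact: coord_continuous.
exact: open_lt.
Qed.

Lemma measurable_coord_ge (i : 'I_d) (a : R) :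
  measurable ([set x : 'rV[R]_d | a <= x ord0 i] : set Rd).
Proof.
rewrite (_ : [set _ | _] = ~` [set x : 'rV[R]_d | x ord0 i < a]).
  by apply: measurableC; exact: measurable_coord_lt.
by apply/seteqP; split=> x /=; rewrite leNgt => /negP.
Qed.

Lemma measurable_coord_le (i : 'I_d) (a : R) :
  measurable ([set x : 'rV[R]_d | x ord0 i <= a] : set Rd).
Proof.
rewrite (_ : [set _ | _] = \bigcap_n [set x : 'rV[R]_d | x ord0 i < a + n.+1%:R^-1]).
  by apply: bigcapT_measurable => n; exact: measurable_coord_lt.
apply/seteqP; split=> x /= => [xa n _|xa].
  by apply: (le_lt_trans xa); rewrite ltrDl invr_gt0.
apply/ler_addgt0Pr => e e0.
have [n ne] : exists n, n.+1%:R^-1 < e.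
  by have /ltr_add_invr[n] := e0; rewrite add0r => ?; exists n.
by apply: le_trans (ltW (xa n I)) _; rewrite lerD2l ltW.
Qed.

Lemma measurable_forall_coord (A : 'I_d -> set Rd) :
  (forall i, measurable (A i)) -> measurable [set x | forall i, A i x].
Proof.
move=> mA; rewrite (_ : [set _ | _] = \bigcap_(i in [set: 'I_d]) A i).
  by apply: fin_bigcap_measurable => //; exact: finite_finset.
by apply/seteqP; split=> x /= h; [move=> i _|move=> i]; exact: h.
Qed.

Lemma measurable_dyadic_cube k m : measurable (cube k m).
Proof.
apply: (@measurable_forall_coord (fun i => [set x : Rd | 2 ^ (- k) * (m i)%:~R <=
  (x : 'rV[R]_d) ord0 i < 2 ^ (- k) * ((m i)%:~R + 1)])) => i.
rewrite (_ : [set _ | _] =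
  ([set x : 'rV[R]_d | 2 ^ (- k) * (m i)%:~R <= x ord0 i] : set Rd) `&`
  [set x : 'rV[R]_d | x ord0 i < 2 ^ (- k) * ((m i)%:~R + 1)]).
  by apply: measurableI; [exact: measurable_coord_ge|exact: measurable_coord_lt].
by apply/seteqP; split=> x /= => [/andP[]//|[-> ->]].
Qed.

Lemma dyadic_cube_lty (mu : {measure set Rd -> \bar R}) k m :
  locally_finite mu -> (mu (cube k m) < +oo)%E.
Proof.
move=> mufin.
pose a i : R := 2 ^ (- k) * (m i)%:~R; pose b i : R := 2 ^ (- k) * ((m i)%:~R + 1).
pose A : set 'rV[R]_d := [set x | forall i, (`[a i, b i]%classic : set R) (x ord0 i)].
apply: (@le_lt_trans _ _ (mu A)); last first.
  apply: mufin; apply: (@rV_compact _ _ (fun i => `[a i, b i]%classic)) => i.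
  exact: segment_compact.
apply: le_measure; rewrite ?inE; first exact: measurable_dyadic_cube.
  apply: (@measurable_forall_coord (fun i => [set x : Rd | (`[a i, b i]%classic : set R) ((x : 'rV[R]_d) ord0 i)])) => i.
  rewrite (_ : [set _ | _] = ([set x : 'rV[R]_d | a i <= x ord0 i] : set Rd) `&`
    [set x : 'rV[R]_d | x ord0 i <= b i]).
    by apply: measurableI; [exact: measurable_coord_ge|exact: measurable_coord_le].
  apply/seteqP; split=> x /=; rewrite in_itv/=; first by move=> /andP[].
  by move=> [-> ->].
by move=> x /= xQ i; rewrite /= in_itv/=; have /andP[-> /ltW ->] := xQ i.
Qed.

Lemma dyadic_cube_neq0 k m : cube k m !=set0.
Proof.
exists (\row_i (2 ^ (- k) * (m i)%:~R)) => i; rewrite mxE lexx/=.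
by rewrite ltr_pM2l ?exprz_gt0// ltrDl.
Qed.

(** Compare the integer endpoints of the two cubes in each coordinate, in units
    of the side of the smaller cube. *)
Lemma dyadic_cube_sub k k' m m' t : (k <= k')%R -> cube k m t -> cube k' m' t ->
  cube k' m' `<=` cube k m.
Proof.
move=> kk' tQ tQ' x xQ' i.
have /andP[t1 t2] := tQ i; have /andP[t1' t2'] := tQ' i.
have /andP[x1 x2] := xQ' i.
have [N kN] : exists N : nat, k' - k = N%:Z.
  by exists `|k' - k|%N; rewrite gez0_abs// subr_ge0.
set c : R := 2 ^ (- k').
have c0 : 0 < c by rewrite exprz_gt0.
have cE : (2 : R) ^ (- k) = c * (2 ^+ N)%:~R.
  have -> : (2 ^+ N)%:~R = (2 : R) ^ N%:Z by rewrite rmorphXn.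
  by rewrite -kN -expfzDr ?pnatr_eq0//; congr (_ ^ _); ring.
have lo : (2 ^+ N * m i <= m' i)%R.
  rewrite -ltzD1 -(ltr_int R) intrD intrM -(ltr_pM2l c0) mulrA -cE.
  exact: le_lt_trans t1 t2'.
have hi : (m' i + 1 <= 2 ^+ N * (m i + 1))%R.
  rewrite lezD1 -(ltr_int R) intrM intrD -(ltr_pM2l c0) mulrA -cE.
  exact: le_lt_trans t1' t2.
apply/andP; split.
  apply: le_trans x1; rewrite cE -mulrA -intrM ler_pM2l// ler_int//.
apply: (lt_le_trans x2); rewrite cE -mulrA -[1]/(1%:~R) -!intrD -intrM ler_pM2l//.
by rewrite ler_int.
Qed.

Lemma dyadic_nested (Q Q' : set Rd) t : dyadic Q -> dyadic Q' -> Q t -> Q' t ->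
  Q `<=` Q' \/ Q' `<=` Q.
Proof.
move=> [k [m ->]] [k' [m' ->]] tQ tQ'; have [kk'|kk'] := leP k k'.
  by right; exact: dyadic_cube_sub kk' tQ tQ'.
by left; exact: dyadic_cube_sub (ltW kk') tQ' tQ.
Qed.

(** An enumeration of the dyadic cubes, with repetitions. *)
Definition dyadic_code (c : nat) : set Rd :=
  if (choice.unpickle c : option (int * {ffun 'I_d -> int})%type) is Some z
  then cube z.1 z.2
  else cube 0 (fun=> 0).

Lemma dyadic_codeP Q : dyadic Q <-> exists c, Q = dyadic_code c.
Proof.
split=> [[k [m ->]]|[c ->]]; last first.
  rewrite /dyadic_code; case: choice.unpickle => [[k m]|]; first by exists k, m.
  by exists 0, (fun=> 0).
exists (choice.pickle (k, finfun m)); rewrite /dyadic_code choice.pickleK/=; congr cube.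
by apply/funext => i; rewrite ffunE.
Qed.

Definition dyadic_upto (M : nat) : set (set Rd) := dyadic_code @` `I_M.

Lemma dyadic_upto_finite M : finite_set (dyadic_upto M).
Proof. exact/finite_image/finite_II. Qed.

Lemma dyadic_upto_sub M : dyadic_upto M `<=` @dyadic R d.
Proof. by move=> _ [c _ <-]; apply/dyadic_codeP; exists c. Qed.

Lemma dyadic_upto_homo M N : (M <= N)%N -> dyadic_upto M `<=` dyadic_upto N.
Proof. by move=> MN _ [c cM <-]; exists c => //=; exact: leq_trans cM MN. Qed.

Lemma dyadic_in_upto Q : dyadic Q -> exists M, dyadic_upto M Q.
Proof. by move=> /dyadic_codeP[c ->]; exists c.+1, c => /=. Qed.

Lemma dyadic_fset_upto (F : {fset set Rd}) : (forall Q, Q \in F -> dyadic Q) ->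
  exists M, forall Q, Q \in F -> dyadic_upto M Q.
Proof.
move=> Fd.
have [s sF] : exists s : seq (set Rd), s = F by exists F.
have : forall Q, Q \in s -> dyadic Q by rewrite sF.
have -> : (exists M, forall Q, Q \in F -> dyadic_upto M Q) =
  (exists M, forall Q, Q \in s -> dyadic_upto M Q) by rewrite sF.
elim: s {sF} => [_|Q s IH sd]; first by exists 0%N.
have [|M sM] := IH; first by move=> Q' Q's; apply: sd; rewrite in_cons Q's orbT.
have [N QN] := dyadic_in_upto (sd Q (mem_head _ _)).
exists (maxn M N) => Q'; rewrite in_cons => /predU1P[->|/sM].
  exact: dyadic_upto_homo (leq_maxr _ _) _ QN.
exact: dyadic_upto_homo (leq_maxl _ _) _.
Qed.

(** A sum over the cubes of a growing family is a sum over all cubes, in which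
    the terms outside the family are replaced by 0. *)
Lemma incr_to_dyadic (D : set (set Rd)) (F : nat -> set Rd -> \bar R) (G : set Rd -> \bar R) :
  (forall Q M, dyadic Q -> 0 <= F M Q)%E ->
  (forall Q, dyadic Q -> incr_to (F^~ Q) (G Q)) ->
  incr_to (fun M => \esum_(Q in [set Q | dyadic_upto M Q /\ D Q]) F M Q)%E
          (\esum_(Q in [set Q | dyadic Q /\ D Q]) G Q)%E.
Proof.
move=> F0 FG.
have -> : (fun M => \esum_(Q in [set Q | dyadic_upto M Q /\ D Q]) F M Q)%E =
  (fun M => \esum_(Q in [set Q | dyadic Q /\ D Q])
     if Q \in dyadic_upto M then F M Q else 0)%E.
  apply/funext => M; rewrite -esum_mkcondr; congr esum.
  apply/seteqP; split=> Q /= => [[QM QD]|[[_ QD] QM]]//; split=> //.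
  by split=> //; exact: dyadic_upto_sub QM.
apply: incr_to_esum => [Q M [Qd _]|Q [Qd _]]; first by case: ifP => // _; exact: F0.
have [Fi FG' GF] := FG Q Qd; split.
- move=> M N MN; case: ifPn => [QM|_]; last by case: ifP => // _; exact: F0.
  rewrite mem_set; first exact: Fi.
  by apply: dyadic_upto_homo MN _ _; rewrite inE in QM.
- move=> M; case: ifP => // _; apply: incr_to_ge0 (FG Q Qd) => M'; exact: F0.
- move=> B FB; apply: GF => M.
  have [N QN] := dyadic_in_upto Qd.
  apply: le_trans (FB (maxn M N)); rewrite mem_set.
    by apply: Fi; exact: leq_maxl.
  exact: dyadic_upto_homo (leq_maxr _ _) _ QN.
Qed.

End DyadicCubes.

(** * From finite families to all dyadic cubes *)

Section Model.
Context {R : realType} {d n : nat}.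
Notation Rd := (borelRd R d).
Variables (p : 'I_n.+1 -> R) (K : set Rd -> R).
Variable sigma : 'I_n.+1 -> {measure set Rd -> \bar R}.
Hypothesis p_gt1 : forall i, 1 < p i.
Hypothesis p_sum : \sum_i (p i)^-1 < 1.
Hypothesis K_ge0 : forall Q, dyadic Q -> 0 <= K Q.
Hypothesis sigma_fin : forall i, locally_finite (sigma i).

Definition family (M : nat) : {fset set Rd} := fset_set (dyadic_upto M).

Definition cube M (x : family M) : set Rd := fsval x.

Lemma in_family M Q : (Q \in family M) = (Q \in dyadic_upto M).
Proof. by rewrite in_fset_set//; exact: dyadic_upto_finite. Qed.

Lemma cube_upto M (x : family M) : dyadic_upto M (cube x).
Proof. by have := fsvalP x; rewrite in_family inE. Qed.

Lemma cube_dyadic M (x : family M) : dyadic (cube x).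
Proof. exact/dyadic_upto_sub/cube_upto. Qed.

Lemma measurable_cube M (x : family M) : measurable (cube x).
Proof. by have [k [m ->]] := cube_dyadic x; exact: measurable_dyadic_cube. Qed.

Lemma cube_inj M : injective (@cube M).
Proof. exact: val_inj. Qed.

Lemma cube_neq0 M (x : family M) : cube x !=set0.
Proof. by have [k [m ->]] := cube_dyadic x; exact: dyadic_cube_neq0. Qed.

Lemma cube_nested M (x y : family M) t : cube x t -> cube y t ->
  cube x `<=` cube y \/ cube y `<=` cube x.
Proof. by apply: dyadic_nested; exact: cube_dyadic. Qed.

Lemma cube_lty i M (x : family M) : (sigma i (cube x) < +oo)%E.
Proof. by have [k [m ->]] := cube_dyadic x; exact: dyadic_cube_lty. Qed.

Definition cube_weight M i (x : family M) : R := weight (@cube M) (sigma i) x.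

Lemma sigma_cube M i (x : family M) : sigma i (cube x) = (mass (cle (@cube M)) (cube_weight i) x)%:E.
Proof.
apply: mu_cube; [exact: measurable_cube|exact: cube_inj|exact: cube_nested|exact: cube_lty].
Qed.

Lemma esum_family M (D : set (set Rd)) (F : set Rd -> \bar R) :
  (forall Q, dyadic Q -> 0 <= F Q)%E ->
  (\esum_(Q in [set Q | dyadic_upto M Q /\ D Q]) F Q =
   \sum_(x : family M | `[< D (cube x) >]) F (cube x))%E.
Proof.
move=> F0; set A := [set _ | _].
have finA : finite_set A.
  by apply: sub_finite_set (dyadic_upto_finite M) => Q [].
rewrite esum_fset//; last first.
  by move=> Q; rewrite inE => -[/dyadic_upto_sub Qd _]; exact: F0.
rewrite fsbig_finite//.
have -> : fset_set A = [fset Q in family M | `[< D Q >]]%fset.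
  apply/fsetP => Q; rewrite in_fset_set// !inE/= in_family.
  apply/idP/andP; first by rewrite inE => -[QM QD]; split; [rewrite inE|exact/asboolP].
  by move=> [/set_mem QM /asboolP QD]; exact/mem_set.
by rewrite -big_fset_condE big_seq_fsetE.
Qed.

(** For the set [D] of all dyadic cubes this is [Kphi]; the finite sets [D] that
    grow to it give the increasing approximations. *)
Fixpoint Krestr (D : set (set Rd)) (phi : 'S_n.+1) (j : nat) (Q : set Rd) : \bar R :=
  (if j is j'.+1 then
    let s := sigma (phi (inord j')) in
    if s Q == 0 then 0
    else Krestr D phi j' Q * s Q *
      ((s Q)^-1 *
       \esum_(Q' in [set Q' | D Q' /\ Q' `<=` Q])
          (Krestr D phi j' Q' * \prod_(i < n.+1 | (j' <= i)%N) sigma (phi i) Q'))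
      `^ (rphi p phi j'.+1 / rphi p phi j' - 1)%R
  else (K Q)%:E)%E.

Lemma Krestr_ge0 D phi j Q : dyadic Q -> (0 <= Krestr D phi j Q)%E.
Proof.
elim: j Q => [|j IH] Q Qd /=; first by rewrite lee_fin K_ge0.
by case: ifP => // _; rewrite !mule_ge0 ?poweR_ge0 ?IH.
Qed.

Lemma p_perm_sum (phi : 'S_n.+1) : \sum_i ((p \o phi) i)^-1 < 1.
Proof. by move: p_sum; rewrite (reindex_inj (@perm_inj _ phi)). Qed.

(** By induction on [j], since products, sums and positive powers preserve
    increasing limits of nonnegative sequences. *)
Lemma Krestr_incr_to (phi : 'S_n.+1) j Q : (j <= n.+1)%N -> dyadic Q ->
  incr_to (fun M => Krestr (dyadic_upto M) phi j Q) (Kphi p K sigma phi j Q).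
Proof.
elim: j Q => [|j IH] Q jn Qd /=; first exact: incr_to_cst.
case: ifPn => [_|sQ0]; first exact: incr_to_cst.
have s1 : 1 < sexpo (p \o phi) j.
  by apply: (@sexpo_gt1 _ _ _ _ _ (Ordinal jn)); [move=> i; exact: p_gt1|exact: p_perm_sum].
have sinv0 : (0 <= (sigma (phi (inord j)) Q)^-1)%E by rewrite inve_ge0.
have T0 M : (0 <= (sigma (phi (inord j)) Q)^-1 *
    \esum_(Q' in [set Q' | dyadic_upto M Q' /\ Q' `<=` Q])
      (Krestr (dyadic_upto M) phi j Q' * \prod_(i < n.+1 | (j <= i)%N) sigma (phi i) Q'))%E.
  rewrite mule_ge0// esum_ge0// => Q' [/dyadic_upto_sub Q'd _].
  by rewrite mule_ge0 ?Krestr_ge0 ?prode_ge0.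
apply: incr_to_mul.
- by move=> M; rewrite mule_ge0 ?Krestr_ge0.
- by move=> M; exact: poweR_ge0.
- apply: incr_to_mul => //; first by move=> M; exact: Krestr_ge0.
    by apply: IH => //; exact: ltnW.
  exact: incr_to_cst.
- apply: incr_to_poweR => //; first by rewrite subr_gt0.
  apply: incr_to_mul => //.
  + move=> M; rewrite esum_ge0// => Q' [/dyadic_upto_sub Q'd _].
    by rewrite mule_ge0 ?Krestr_ge0 ?prode_ge0.
  + exact: incr_to_cst.
  + apply: (@incr_to_dyadic _ _ (fun Q' => Q' `<=` Q) (fun M Q' =>
      (Krestr (dyadic_upto M) phi j Q' * \prod_(i < n.+1 | (j <= i)%N) sigma (phi i) Q')%E)).
      by move=> Q' M Q'd; rewrite mule_ge0 ?Krestr_ge0 ?prode_ge0.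
    move=> Q' Q'd; apply: incr_to_mul.
    * by move=> M; exact: Krestr_ge0.
    * by move=> M; exact: prode_ge0.
    * by apply: IH => //; exact: ltnW.
    * exact: incr_to_cst.
Qed.

Definition family_K M (phi : 'S_n.+1) j (x : family M) : R :=
  Kdisc (cle (@cube M)) (p \o phi) (fun i => cube_weight (phi i)) (fun x => K (cube x)) j x.

Lemma Krestr_family_K M phi j (x : family M) :
  Krestr (dyadic_upto M) phi j (cube x) = (family_K phi j x)%:E.
Proof.
elim: j x => [//|j IH] x /=.
rewrite /family_K/= sigma_cube eqe; case: ifPn => [/eqP ->|m0].
  by rewrite mulr0 mul0r.
rewrite IH inver (negbTE m0) esum_family; last first.
  by move=> Q Qd; rewrite mule_ge0 ?Krestr_ge0 ?prode_ge0.
rewrite (eq_bigr (fun y => (family_K phi j y *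
   \prod_(i < n.+1 | (j <= i)%N) mass (cle (@cube M)) (cube_weight (phi i)) y)%:E)) => [|y _]; last first.
  by rewrite IH EFinM -prodEFin; congr (_ * _)%E; apply: eq_bigr => i _; rewrite sigma_cube.
by rewrite sumEFin.
Qed.

Definition family_testing M (phi : 'S_n.+1) : R :=
  testing_sum (cle (@cube M)) (p \o phi) (fun i => cube_weight (phi i)) (fun x => K (cube x)).

Lemma cube_weight_ge0 M i (x : family M) : 0 <= cube_weight i x.
Proof. exact: weight_ge0. Qed.

Lemma family_K_ge0 M phi j (x : family M) : 0 <= family_K phi j x.
Proof.
apply: Kdisc_ge0 => [i y|y]; first exact: cube_weight_ge0.
exact/K_ge0/cube_dyadic.
Qed.

Lemma esum_Krestr M phi t :
  (\esum_(Q in [set Q | dyadic_upto M Q /\ [set: set Rd] Q])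
     (Krestr (dyadic_upto M) phi n Q * (\1_Q t)%:E) =
   (stepf (@cube M)
      (fun y => (\sum_(x | cle (@cube M) y x) family_K phi n x)%R) t)%:E)%E.
Proof.
rewrite esum_family; last by move=> Q Qd; rewrite mule_ge0 ?Krestr_ge0 ?lee_fin.
under eq_bigr do rewrite Krestr_family_K -EFinM.
rewrite sumEFin; congr EFin.
have [[y yt]|nt] := pselect (exists y, atom (@cube M) y t).
  rewrite (stepf_atom (@cube_inj M) (@cube_nested M) _ yt).
  rewrite [LHS]big_mkcond [RHS]big_mkcond/=; apply: eq_bigr => x _.
  rewrite asboolT//; case: ifPn => [/asboolP yx|yx].
    by rewrite indicE mem_set ?mulr1//; exact/yx/(atom_cube yt).
  rewrite indicE memNset ?mulr0// => xt; move/negP: yx; apply.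
  exact: (atom_cle (@cube_nested M) yt xt).
rewrite stepf_out => [|y yt]; last by apply: nt; exists y.
rewrite big1// => x _; rewrite indicE memNset ?mulr0// => xt.
have [y _ yt] := cube_atom (@cube_inj M) (@cube_nested M) xt.
by apply: nt; exists y.
Qed.

(** On the atoms of a finite family the integrand is a step function, and its
    integral is the discrete testing sum. *)
Lemma testing_incr_to (phi : 'S_n.+1) : incr_to (fun M => (family_testing M phi)%:E)
  (\int[sigma (phi ord_max)]_t
    (\esum_(Q in @dyadic R d) (Kphi p K sigma phi n Q * (\1_Q t)%:E)) `^ sexpo (p \o phi) n)%E.
Proof.
have p1 i : 1 < (p \o phi) i by exact: p_gt1.
have s1 : 1 < sexpo (p \o phi) n := sexpo_gt1 p1 (p_perm_sum phi) ord_max.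
have s0 : 0 < sexpo (p \o phi) n by exact: lt_trans s1.
pose c M (y : family M) := \sum_(x | cle (@cube M) y x) family_K phi n x.
have c0 M y : 0 <= c M y by apply: sumr_ge0 => x _; exact: family_K_ge0.
have -> : (fun M => (family_testing M phi)%:E) = (fun M =>
    \int[sigma (phi ord_max)]_t
      (stepf (@cube M) (fun y => c M y `^ sexpo (p \o phi) n) t)%:E)%E.
  apply/funext => M; rewrite integral_stepf//.
  - exact: measurable_cube.
  - exact: cube_lty.
  - by move=> y; exact: powR_ge0.
apply: incr_to_integral.
- move=> M; apply/measurable_EFinP; apply: measurable_stepf; exact: measurable_cube.
- move=> M t; rewrite lee_fin /stepf sumr_ge0// => y _.
  by rewrite mulr_ge0 ?powR_ge0.
move=> t.
have -> : (fun M => (stepf (@cube M) (fun y => c M y `^ sexpo (p \o phi) n) t)%:E) =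
   (fun M => (\esum_(Q in [set Q | dyadic_upto M Q /\ [set: set Rd] Q])
     (Krestr (dyadic_upto M) phi n Q * (\1_Q t)%:E)) `^ sexpo (p \o phi) n)%E.
  apply/funext => M; rewrite esum_Krestr poweR_EFin; congr EFin.
  rewrite (@stepf_comp _ _ _ _ _ (@cube_inj M) (@cube_nested M)
    (fun u => u `^ sexpo (p \o phi) n))//.
  by rewrite powR0// gt_eqF.
apply: incr_to_poweR => //.
  move=> M; apply: esum_ge0 => Q [/dyadic_upto_sub Qd _].
  by rewrite mule_ge0 ?Krestr_ge0 ?lee_fin.
rewrite [X in incr_to _ (esum X _)](_ : _ = [set Q | dyadic Q /\ [set: set Rd] Q]); last first.
  by apply/seteqP; split=> Q //= [].
apply: (@incr_to_dyadic _ _ setT (fun M Q => (Krestr (dyadic_upto M) phi n Q * (\1_Q t)%:E)%E)).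
  by move=> Q M Qd; rewrite mule_ge0 ?Krestr_ge0 ?lee_fin.
move=> Q Qd; apply: incr_to_mul.
- by move=> M; exact: Krestr_ge0.
- by move=> M; rewrite lee_fin.
- exact: Krestr_incr_to.
- exact: incr_to_cst.
Qed.

Lemma rexpE (phi : 'S_n.+1) : rexp p = rexpo (p \o phi) n.+1.
Proof.
rewrite /rexp /rexpo theta_max; congr (_ - _)^-1.
exact: (reindex_inj (@perm_inj _ phi)).
Qed.

(** The norm is the power 1 / r of the integral in [testing_incr_to]. *)
Lemma testing_boundP c : 0 <= c -> testing_bound p K sigma c <->
  forall M phi, family_testing M phi <= c `^ rexp p.
Proof.
move=> c0.
have step (phi : 'S_n.+1) : ('N[sigma (phi ord_max)]_(rexp p)%:E
      [(fun x => (\esum_(Q in @dyadic R d) (Kphi p K sigma phi n Q * (\1_Q x)%:E))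
                 `^ (rphi p phi n)^-1)] <= c%:E)%E <->
    forall M, family_testing M phi <= c `^ rexp p.
  have p1 i : 1 < (p \o phi) i by exact: p_gt1.
  have r0 : 0 < rexp p.
    by rewrite (rexpE phi) invr_gt0 (theta_gt0 p1 (p_perm_sum phi)).
  have rn0 : rexp p != 0 by rewrite gt_eqF.
  rewrite unlock.
  have -> : (\int[sigma (phi ord_max)]_x
      `|(\esum_(Q in @dyadic R d) (Kphi p K sigma phi n Q * (\1_Q x)%:E)) `^ (rphi p phi n)^-1|
        `^ rexp p =
    \int[sigma (phi ord_max)]_x
      (\esum_(Q in @dyadic R d) (Kphi p K sigma phi n Q * (\1_Q x)%:E)) `^ sexpo (p \o phi) n)%E.
    apply: eq_integral => x _; rewrite gee0_abs ?poweR_ge0// -poweRrM.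
    by rewrite mulrC (rexpE phi).
  set X := (\int[_]_x _)%E.
  have X0 : (0 <= X)%E by apply: integral_ge0 => x _; exact: poweR_ge0.
  have XP : (X `^ (rexp p)^-1 <= c%:E)%E <-> (X <= (c `^ rexp p)%:E)%E.
    rewrite -poweR_EFin; split=> h.
      have <- : ((X `^ (rexp p)^-1) `^ rexp p)%E = X.
        by rewrite -poweRrM mulVf// poweRe1.
      by apply: lee_poweR => //; [exact: ltW|exact: poweR_ge0].
    rewrite -[c%:E](@poweRK _ _ (rexp p))//.
    by apply: lee_poweR => //; rewrite invr_ge0 ltW.
  have [_ ub lub] := testing_incr_to phi.
  split=> [/XP h M|h]; first by rewrite -lee_fin; exact: le_trans (ub M) h.
  by apply/XP; apply: lub => M; rewrite lee_fin.
split=> [tb M phi|tb phi]; first exact: (step phi).1 (tb phi) M.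
by apply: (step phi).2 => M; exact: tb.
Qed.

Definition family_embedding M c : Prop :=
  embedding_discrete (cle (@cube M)) p (@cube_weight M) (fun x => K (cube x)) c.

(** Step functions turn the embedding into its discrete form.  Conversely, a
    finite partial sum only involves the integrals of the functions over the
    cubes of some family, and these are at most the integrals of the averages
    over atoms. *)
Lemma embedding_boundP c : 0 <= c -> embedding_bound p K sigma c <->
  forall M, family_embedding M c.
Proof.
have p0 i : 0 < p i by exact: lt_trans (p_gt1 i).
have p1 i : (1 <= p i) by exact: ltW.
move=> c0; split=> [eb M g g0|ed f fL].
  have := eb (fun i => stepf (@cube M) (g i)) _.
  move=> /(_ _)/wrap[].
    move=> i; apply: stepf_Lfun => //.
    - exact: measurable_cube.
    - exact: cube_inj.
    - exact: cube_nested.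
    - exact: cube_lty.
  have -> : (\prod_(i < n.+1) 'N[sigma i]_(p i)%:E [EFin \o stepf (@cube M) (g i)])%E =
      (\prod_i (\sum_y g i y `^ p i * cube_weight i y) `^ (p i)^-1)%:E.
    rewrite -prodEFin; apply: eq_bigr => i _; apply: Lnorm_stepf => //.
    - exact: measurable_cube.
    - exact: cube_inj.
    - exact: cube_nested.
    - exact: cube_lty.
  rewrite -EFinM => h; rewrite -lee_fin; apply: le_trans h.
  rewrite -sumEFin.
  set F := (fun Q : set Rd => ((K Q)%:E * \prod_(i < n.+1)
     `|\int[sigma i]_(x in Q) (stepf (@cube M) (g i) x)%:E|)%E).
  have F0 Q : dyadic Q -> (0 <= F Q)%E.
    by move=> Qd; rewrite mule_ge0 ?lee_fin ?K_ge0 ?prode_ge0.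
  have -> : (\sum_x (K (cube x) * \prod_i
      mass (cle (@cube M)) (fun y => g i y * cube_weight i y) x)%:E =
      \esum_(Q in [set Q | dyadic_upto M Q /\ [set: set Rd] Q]) F Q)%E.
    rewrite esum_family//; apply: eq_big => [x|x _]; first by rewrite asboolT.
    rewrite /F EFinM; congr (_ * _)%E; rewrite -prodEFin; apply: eq_bigr => i _.
    rewrite integral_cube_stepf.
    + rewrite gee0_abs// lee_fin mass_ge0// => y.
      by rewrite mulr_ge0 ?cube_weight_ge0.
    + exact: measurable_cube.
    + exact: cube_inj.
    + exact: cube_nested.
    + exact: cube_lty.
  rewrite -[X in (_ <= X)%E]/(\esum_(Q in @dyadic R d) F Q)%E.
  apply: ereal_sup_le => _ [A [finA AD] <-]; exists A => //; split=> // Q /AD[].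
  by move=> /dyadic_upto_sub.
apply: ge_ereal_sup => _ [A [finA AD] <-].
have [M AM] : exists M, forall Q, Q \in fset_set A -> dyadic_upto M Q.
  by apply: dyadic_fset_upto => Q; rewrite in_fset_set// inE => /AD.
set F := (fun Q : set Rd => ((K Q)%:E * \prod_(i < n.+1)
   `|\int[sigma i]_(x in Q) (f i x)%:E|)%E).
have F0 Q : dyadic Q -> (0 <= F Q)%E.
  by move=> Qd; rewrite mule_ge0 ?lee_fin ?K_ge0 ?prode_ge0.
apply: (@le_trans _ _ (\esum_(Q in [set Q | dyadic_upto M Q /\ [set: set Rd] Q]) F Q)%E).
  apply: ereal_sup_ubound; exists A => //; split=> // Q QA; split=> //.
  by apply: AM; rewrite in_fset_set// inE.
rewrite esum_family//.
pose g i := atom_avg (@cube M) (sigma i) (f i).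
have g0 i y : 0 <= g i y by exact: atom_avg_ge0.
apply: (@le_trans _ _ (\sum_(x : family M) (K (cube x) * \prod_i
    mass (cle (@cube M)) (fun y => g i y * cube_weight i y) x)%:E)%E).
  rewrite (eq_bigl xpredT) => [|x]; last by rewrite asboolT.
  apply: lee_sum => x _; rewrite /F EFinM lee_wpmul2l//.
    by rewrite lee_fin K_ge0//; exact: cube_dyadic.
  rewrite -prodEFin; apply: lee_prod => i; rewrite abse_ge0/=.
  apply: (@abse_integral_cube_le _ _ _ _ _ _ _ _ _ _ (f i) (p i)) => //.
  - exact: measurable_cube.
  - exact: cube_inj.
  - exact: cube_nested.
  - exact: cube_lty.
rewrite sumEFin; apply: (@le_trans _ _ (c * \prod_i
   (\sum_y g i y `^ p i * cube_weight i y) `^ (p i)^-1)%:E).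
  by rewrite lee_fin; exact: ed.
rewrite EFinM lee_wpmul2l ?lee_fin// -prodEFin; apply: lee_prod => i.
rewrite lee_fin powR_ge0/=.
apply: atom_avg_Lnorm_le => //.
- exact: measurable_cube.
- exact: cube_inj.
- exact: cube_nested.
- exact: cube_lty.
Qed.

Lemma testing_embedding c : 0 <= c -> testing_bound p K sigma c ->
  embedding_bound p K sigma
    ((\sum_(phi : 'S_n.+1) sufficiency_const (p \o phi)) * c).
Proof.
move=> c0 /(testing_boundP c0) tb.
have S0 : 0 <= \sum_(phi : 'S_n.+1) sufficiency_const (p \o phi).
  by apply: sumr_ge0 => phi _; exact: sufficiency_const_ge0.
apply/embedding_boundP => [|M]; first by rewrite mulr_ge0.
apply: testing_embedding_discrete => //.
- exact: cle_refl.
- exact/cle_anti/cube_inj.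
- exact: cle_trans.
- exact: (cle_forest (@cube_neq0 M) (@cube_nested M)).
- by move=> i x; exact: cube_weight_ge0.
- by move=> x; exact/K_ge0/cube_dyadic.
- by move=> phi; rewrite -rexpE; exact: tb.
Qed.

(** The embedding does not depend on the order of the measures, so the discrete
    result for one order applies to each permutation of them. *)
Lemma embedding_testing c : 0 <= c -> embedding_bound p K sigma c ->
  testing_bound p K sigma ((\sum_(phi : 'S_n.+1)
    necessity_const (p \o phi) n `^ theta (p \o phi) n) * c).
Proof.
move=> c0 /(embedding_boundP c0) eb.
have S0 : 0 <= \sum_(phi : 'S_n.+1) necessity_const (p \o phi) n `^ theta (p \o phi) n.
  by apply: sumr_ge0 => phi _; exact: powR_ge0.
apply/testing_boundP => [|M phi]; first by rewrite mulr_ge0.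
have p1 i : 1 < (p \o phi) i by exact: p_gt1.
have Ephi : embedding_discrete (cle (@cube M)) (p \o phi) (fun i => cube_weight (phi i))
    (fun x => K (cube x)) c.
  move=> g g0; have := eb M (fun i => g ((phi^-1)%g i)) (fun i => g0 _).
  have -> : \prod_i (\sum_y g ((phi^-1)%g i) y `^ p i * cube_weight i y) `^ (p i)^-1 =
      \prod_i (\sum_y g i y `^ (p \o phi) i * cube_weight (phi i) y) `^ ((p \o phi) i)^-1.
    rewrite (reindex_inj (@perm_inj _ phi)); apply: eq_bigr => i _.
    by rewrite permK.
  apply: le_trans; apply: ler_sum => x _.
  rewrite [in leRHS](reindex_inj (@perm_inj _ phi))/=.
  by under [in leRHS]eq_bigr do rewrite permK.
apply: le_trans (embedding_discrete_testing _ _ _ _ p1 (p_perm_sum phi) _ _ c0 Ephi) _.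
- exact: cle_refl.
- exact/cle_anti/cube_inj.
- exact: cle_trans.
- exact: (cle_forest (@cube_neq0 M) (@cube_nested M)).
- by move=> i x; exact: cube_weight_ge0.
- by move=> x; exact/K_ge0/cube_dyadic.
rewrite (rexpE phi); apply: powR_le2r.
- by rewrite invr_ge0 ltW// (theta_gt0 p1 (p_perm_sum phi)).
- by rewrite mulr_ge0 ?powR_ge0.
- by rewrite ler_wpM2r// (bigD1 phi)//= lerDl sumr_ge0// => psi _; exact: powR_ge0.
Qed.

End Model.

Theorem theorem1p4 (R : realType) (d n : nat) (p : 'I_n.+2 -> R)
    (d_gt0 : (0 < d)%N)
    (p_gt1 : forall i, 1 < p i)
    (p_sum : \sum_(i < n.+2) (p i)^-1 < 1) :
  exists C : R, 0 < C /\
    forall (K : set (borelRd R d) -> R)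
           (sigma : 'I_n.+2 -> {measure set (borelRd R d) -> \bar R}),
      (forall Q, dyadic Q -> 0 <= K Q) ->
      (forall i, locally_finite (sigma i)) ->
      [/\ (exists c1 : R, embedding_bound p K sigma c1) <->
            (exists c2 : R, testing_bound p K sigma c2),
          (least_constant (embedding_bound p K sigma)
            <= C%:E * least_constant (testing_bound p K sigma))%E &
          (least_constant (testing_bound p K sigma)
            <= C%:E * least_constant (embedding_bound p K sigma))%E].
Proof.
pose C1 := \sum_(phi : 'S_n.+2) sufficiency_const (p \o phi).
pose C2 := \sum_(phi : 'S_n.+2) necessity_const (p \o phi) n.+1 `^ theta (p \o phi) n.+1.
have C10 : 0 <= C1.
  by apply: sumr_ge0 => phi _; exact: sufficiency_const_ge0.
have C20 : 0 <= C2 by apply: sumr_ge0 => phi _; exact: powR_ge0.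
have C0 : 0 < C1 + C2 + 1 by rewrite ltr_wpDl// addr_ge0.
exists (C1 + C2 + 1); split=> // K sigma K0 sfin.
(* an infimum over the empty set is infinite, and the product with the positive
   constant stays infinite *)
have least_le (P P' : R -> Prop) A : 0 <= A -> A <= C1 + C2 + 1 ->
    (forall c, 0 <= c -> P c -> P' (A * c)) ->
    (least_constant P' <= (C1 + C2 + 1)%:E * least_constant P)%E.
  move=> A0 AC PP'; rewrite -lee_pdivrMl//.
  apply: le_ereal_inf_tmp => _ [c [c0 Pc] <-]; rewrite lee_pdivrMl//.
  apply: (@le_trans _ _ (A * c)%:E).
    apply: ereal_inf_lbound; exists (A * c) => //; split; first exact: mulr_ge0.
    exact: PP'.
  by rewrite -EFinM lee_fin ler_wpM2r.
have ET := embedding_testing p_gt1 p_sum K0 sfin.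
have TE := testing_embedding p_gt1 p_sum K0 sfin.
split.
- split=> [[c eb]|[c tb]].
    exists (C2 * Num.max c 0); apply: ET; first by rewrite le_max lexx orbT.
    move=> f fL; apply: le_trans (eb f fL) _.
    by rewrite lee_wpmul2r ?prode_ge0// ?lee_fin ?le_max ?lexx// => i _; exact: Lnorm_ge0.
  exists (C1 * Num.max c 0); apply: TE; first by rewrite le_max lexx orbT.
  by move=> phi; apply: le_trans (tb phi) _; rewrite lee_fin le_max lexx.
- by apply: (least_le _ _ C1) => //; lra.
- by apply: (least_le _ _ C2) => //; lra.
Qed.
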